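(* For every $C,\epsilon>0$, there exist a positive integer $k=k(C,\epsilon)$ and a constant $L=L(C,\epsilon)$ such that, for all sufficiently large $n$ (in terms of $C,\epsilon$), every graph $H$ on at most $n$ vertices with $\mathrm{degen}(H)\le C\frac{\log n}{\log\log n}$ and maximum degree at most $n^{1-\epsilon}$ satisfies $p_k(H)\le L\,q(H)$.
   Context: Graphs are finite and simple. For a finite set $X$ and $p\in[0,1]$, $\mu_p$ is the product measure on $2^X$: $\mu_p(\{A\})=p^{|A|}(1-p)^{|X\setminus A|}$. A family $\mathcal F\subseteq 2^X$ is increasing if closed under supersets and decreasing if closed under subsets. For a decreasing family $\mathcal D\subseteq 2^X$, $\mathcal D_{(k)}:=\{D_1\cup\cdots\cup D_k: D_i\in\mathcal D\}$. For an increasing family $\mathcal I\subseteq 2^X$, the $k$-threshold $p_k(\mathcal I)$ is the infimum of the set of $p\in[0,1]$ such that for every decreasing $\mathcal D\subseteq 2^X$ with $\mu_p(\mathcal D)\ge 1-\frac1{2k}$ we have $\mathcal D_{(k)}\cap\mathcal I\neq\emptyset$. For $S\subseteq X$ let $\langle S\rangle:=\{T\subseteq X:T\supseteq S\}$. A family $\mathcal I\subseteq2^X$ is $p$-small if there is $\mathcal G\subseteq 2^X$ with $\mathcal I\subseteq\bigcup_{S\in\mathcal G}\langle S\rangle$ and $\sum_{S\in\mathcal G}\mu_p(\langle S\rangle)\le1/2$. The expectation threshold is $q(\mathcal I)=\max\{p:\mathcal I\text{ is }p\text{-small}\}$. Take $X=\binom{[n]}2$ and identify elements of $2^{\binom{[n]}2}$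 with graphs on vertex set $[n]$. For a graph $H$ on at most $n$ vertices, $\mathcal I_H\subseteq 2^{\binom{[n]}2}$ is the family of all graphs on $[n]$ having a subgraph isomorphic to $H$; $p_k(H):=p_k(\mathcal I_H)$ and $q(H):=q(\mathcal I_H)$, with the convention $p_k(H)=q(H)=0$ if $H$ has no edges. The degeneracy $\mathrm{degen}(H)$ is the smallest integer $d$ such that every nonempty subgraph of $H$ has minimum degree at most $d$; equivalently, the smallest $d$ such that the vertices of $H$ can be ordered so that every vertex has at most $d$ neighbors preceding it. *)

(* Defs.v *)
From HB Require Import structures.
From mathcomp Require Import all_boot all_order all_algebra.
From mathcomp Require Import all_classical all_reals all_analysis.

Set Implicit Arguments.
Unset Strict Implicit.
Unset Printing Implicit Defensive.

Import Order.TTheory GRing.Theory Num.Theory.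

Local Open Scope ring_scope.

Section Families.
Variables (R : realType) (X : finType).
Implicit Types (p : R) (A B S T : {set X}) (F D I G : {set {set X}}) (k : nat).

Definition mu p F : R :=
  \sum_(A in F) p ^+ #|A| * (1 - p) ^+ #|~: A|.

Definition decreasing_family D : Prop :=
  forall A B, B \subset A -> A \in D -> B \in D.

Definition k_unions k D : {set {set X}} :=
  [set \bigcup_(i < k) f i | f : {ffun 'I_k -> {set X}} in ffun_on (mem D)].

(* The set below contains p = 1 as soon as I is nonempty and increasing and
   k > 0, so [inf] is then a genuine infimum. *)
Definition k_threshold k I : R :=
  inf [set p : R | 0 <= p <= 1 /\
    forall D, decreasing_family D -> mu p D >= 1 - (2 * k%:R)^-1 ->
      k_unions k D :&: I != finset.set0]%classic.

Definition up_set S : {set {set X}} := [set T : {set X} | S \subset T]%SET.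

Definition p_small p I : Prop :=
  exists G, I \subset (\bigcup_(S in G) up_set S)%SET /\
    \sum_(S in G) mu p (up_set S) <= 2^-1.

(* The p in [0, 1] for which I is p-small form a closed set (there are finitely
   many G, and each sum is continuous in p), so this [sup] is a maximum when
   the set is nonempty, i.e., when the empty set is not in I. *)
Definition expectation_threshold I : R :=
  sup [set p : R | 0 <= p <= 1 /\ p_small p I]%classic.

End Families.

(* [vpair V] is the set of unordered pairs of distinct vertices; a graph on V is
   identified with its edge set. *)
Definition vpair (V : finType) : finType := {e : {set V} | #|e| == 2%N}.

Definition graph (V : finType) : finType := {set vpair V}.

Section Graphs.
Variable V : finType.
Implicit Types (H F : graph V) (U : {set V}) (x y v : V) (d : nat).

Definition adj H x y : bool := [exists e in H, val e == [set x; y]%SET].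

Definition degree H v : nat := #|[set w | adj H v w]%SET|.

Definition max_degree H : nat := \max_(v : V) degree H v.

(* The graph with vertex set U and edge set F is a subgraph of H. *)
Definition subgraph U F H : bool :=
  (F \subset H) && [forall e in F, val e \subset U].

(* Minimum degree of the graph with (nonempty) vertex set U and edge set F; the
   initial value #|V| exceeds every degree. *)
Definition min_degree U F : nat := \big[minn/#|V|]_(v in U) degree F v.

Definition degen_le H d : bool :=
  [forall U : {set V}, forall F : graph V,
    (U != finset.set0) && subgraph U F H ==> (min_degree U F <= d)%N].

Lemma degen_le_ex H : exists d, degen_le H d.
Proof.
exists #|V|; apply/forallP => U; apply/forallP => F; apply/implyP => _.
rewrite /min_degree; elim/big_rec: _ => // v m _ le_m.
exact: leq_trans (geq_minr _ _) le_m.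
Qed.

Definition degen H : nat := ex_minn (degen_le_ex H).

End Graphs.

(* f is an isomorphism from H onto the graph with vertex set U and edge set F. *)
Definition isomorphism (V W : finType) (H : graph V) (U : {set W}) (F : graph W)
    (f : {ffun V -> W}) : bool :=
  [&& injectiveb f, [set f x | x : V]%SET == U
    & [forall x, forall y, adj F (f x) (f y) == adj H x y]].

Definition contains_copy (V W : finType) (H : graph V) (G : graph W) : bool :=
  [exists U : {set W}, exists F : graph W,
    subgraph U F G && [exists f, isomorphism H U F f]].

Section GraphThresholds.
Variables (R : realType) (V : finType).
Implicit Types (H : graph V) (n k : nat).

Definition containing n H : {set {set vpair 'I_n}} :=
  [set G : graph 'I_n | contains_copy H G]%SET.

Definition graph_k_threshold k n H : R :=
  if H == finset.set0 then 0 else k_threshold R k (containing n H).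

Definition graph_expectation_threshold n H : R :=
  if H == finset.set0 then 0 else expectation_threshold R (containing n H).

End GraphThresholds.

(* Main.v *)
(* If H is a union of k graphs F_j, each contained in G(n, p) with probability
   more than 1 - 1/(2k), then p_k(H) <= p.  Indeed a copy of F_j found in G(n, p)
   becomes a uniformly random copy after a random relabelling of the vertices, so
   a uniformly random copy of F_j lies outside a given decreasing D with
   mu_p(D) >= 1 - 1/(2k) with probability less than 1/k; hence some relabelling
   puts all the F_j in D at the same time.

   It remains to cut H into boundedly many pieces contained in G(n, L q(H)).
   Order the vertices by degeneracy, and split the earlier neighbours of each
   vertex into k0 ~ 8/eps groups and the vertices into 64 classes, so that each
   piece leaves most of [n] free.  Let d = degen H.  Counting the copies of a
   subgraph of minimum degree d gives q(H) >= n^(-2/d) / 2.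

   If d >= k0, then in a piece every vertex has at most d' <= 2d/k0 earlier
   neighbours and p^d' >= n^(-eps/2) for p = L q(H): the vertices can be embedded
   one by one, testing only n^(eps/2) log n fresh candidates for each of them,
   and the bound on the maximum degree ensures that fresh candidates remain.

   If d < k0, the pieces are star forests (up to a 2-colouring).  For stars with
   a_1 >= a_2 >= ... leaves, counting the copies of the first j stars, pruned to
   a_j leaves, gives q(H) >= (a_j/32n) (j/n)^(1/a_j).  For p = L q(H) this provides
   many more than j vertices of degree at least a_j, for every j, which is all
   that is needed to embed the stars greedily. *)
Require Import Defs.
From mathcomp Require Import all_boot all_order all_algebra all_fingroup.
From mathcomp Require Import all_classical all_reals all_analysis.
From mathcomp Require Import fintype finset ring lra zify.

Set Implicit Arguments.
Unset Strict Implicit.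
Unset Printing Implicit Defensive.

Import Order.TTheory GRing.Theory Num.Theory.

Local Open Scope ring_scope.

(** * Product measure and exposure of a random set *)

Section ProductMeasure.
Variables (R : realType) (X : finType) (p : R).
Hypotheses (p0 : 0 <= p) (p1 : p <= 1).
Implicit Types (A B E Q S : {set X}) (I : {set {set X}}) (h : {set X} -> R).

Definition set_weight A : R := p ^+ #|A| * (1 - p) ^+ #|~: A|.

Lemma set_weight_ge0 A : 0 <= set_weight A.
Proof. by rewrite /set_weight mulr_ge0// exprn_ge0// subr_ge0. Qed.

Lemma set_weight_sum1 : \sum_A set_weight A = 1.
Proof.
rewrite (partition_big (fun A : {set X} => inord #|A| : 'I_#|X|.+1) predT)//=.
have -> : 1 = ((1 - p) + p) ^+ #|X| by rewrite subrK expr1n.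
rewrite exprDn; apply: eq_bigr => i _.
transitivity (\sum_(A in [set A : {set X} | #|A| == i]) (1 - p) ^+ (#|X| - i) * p ^+ i).
  apply: eq_big => [A|A /eqP Ai].
    rewrite !inE; apply/eqP/eqP => [<-|cA]; last by rewrite cA inord_val.
    by rewrite inordK// ltnS max_card.
  have cA : #|A| = i by rewrite -Ai inordK// ltnS max_card.
  by rewrite /set_weight mulrC [#|~: A|]cardsCs setCK cA.
by rewrite sumr_const card_draws.
Qed.

Definition mean h : R := \sum_A set_weight A * h A.

(** Conditioning on the status of [x]: neither function on the right depends on it any more.
    Concretely, the sets avoiding [x] are paired with those containing it. *)
Lemma mean_query x h :
  mean h = p * mean (fun A => h (x |: A)) + (1 - p) * mean (fun A => h (A :\ x)).
Proof.
have key g : mean g = \sum_(A : {set X} | x \notin A) (set_weight A * g A + set_weight (x |: A) * g (x |: A)).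
  rewrite /mean (bigID (fun A : {set X} => x \notin A))/= big_split/=; congr (_ + _).
  rewrite (reindex_onto (fun A : {set X} => x |: A) (fun A => A :\ x))/=; last first.
    by move=> A; rewrite negbK => xA; rewrite setD1K.
  apply: eq_bigl => A; rewrite setU11/=; apply/eqP/idP => [<-|xA].
    by rewrite !inE eqxx.
  by rewrite setU1K.
rewrite !key !mulr_sumr -big_split/=; apply: eq_bigr => A xA.
have cA : #|~: A| = #|~: (x |: A)|.+1.
  by rewrite setCU (cardsD1 x) !inE xA/= setDE setIC add1n.
have -> : set_weight (x |: A) = p * (p ^+ #|A| * (1 - p) ^+ #|~: (x |: A)|).
  by rewrite /set_weight cardsU1 xA/= add1n exprS mulrA.
have -> : set_weight A = (1 - p) * (p ^+ #|A| * (1 - p) ^+ #|~: (x |: A)|).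
  by rewrite /set_weight cA exprS mulrCA.
rewrite setUA setUid setU1K//.
have -> : A :\ x = A by apply/setDidPl; rewrite disjoint_sym disjoints1.
set w := _ * (1 - p) ^+ _; ring.
Qed.

Lemma mean_le h h' : (forall A, h A <= h' A) -> mean h <= mean h'.
Proof. by move=> hh; apply: ler_sum => A _; rewrite ler_wpM2l ?set_weight_ge0. Qed.

Lemma mu_mean (F : {set {set X}}) : mu p F = mean (fun A => (A \in F)%:R).
Proof.
rewrite /mu /mean big_mkcond/=; apply: eq_bigr => A _.
by rewrite /set_weight; case: ifP; rewrite ?mulr1 ?mulr0.
Qed.

Lemma mu_up_set S : mu p (up_set S) = p ^+ #|S|.
Proof.
rewrite mu_mean; move: {2}#|S| (erefl #|S|) => m; elim: m S => [|m IH] S cS.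
  rewrite cS expr0 (cards0_eq cS) -[RHS]set_weight_sum1; apply: eq_bigr => A _.
  by rewrite inE sub0set mulr1.
have [x xS] : exists x, x \in S by apply/set0Pn; rewrite -card_gt0 cS.
have cS' : #|S :\ x| = m by move: cS; rewrite (cardsD1 x) xS add1n => -[].
rewrite (mean_query x) cS exprS -cS' -(IH _ cS').
have -> : mean (fun A => (A :\ x \in up_set S)%:R) = 0.
  apply: big1 => A _; rewrite inE; case: (boolP (S \subset _)) => [/subsetP/(_ _ xS)|_].
    by rewrite !inE eqxx.
  by rewrite mulr0.
rewrite mulr0 addr0; congr (_ * _); apply: eq_bigr => A _; congr (_ * _%:R).
by rewrite !inE -subDset.
Qed.

Variable (I : {set {set X}}).

(* The failure probability after the elements of Q have been exposed and those of
   E found present; the status of the elements outside Q is still random. *)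
Definition fail_prob Q E : R := mean (fun A => (E :|: (A :\: Q) \notin I)%:R).

Lemma fail00 : fail_prob set0 set0 = 1 - mu p I.
Proof.
rewrite mu_mean -[X in X - _]set_weight_sum1 /fail_prob /mean -sumrB; apply: eq_bigr => A _.
by rewrite set0U setD0; case: (A \in I); rewrite ?mulr0 ?mulr1 ?subrr ?subr0.
Qed.

Lemma fail_le1 Q E : fail_prob Q E <= 1.
Proof.
rewrite -set_weight_sum1; apply: ler_sum => A _.
by case: (_ \notin I); rewrite ?mulr1 ?mulr0 ?set_weight_ge0.
Qed.

Hypothesis I_incr : forall A B, A \subset B -> A \in I -> B \in I.

(** Ignoring more elements and crediting fewer can only shrink the set that is tested for membership
    in the increasing family [I]. *)
Lemma fail_mono Q Q' E E' : Q \subset Q' -> E' \subset E -> fail_prob Q E <= fail_prob Q' E'.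
Proof.
move=> QQ EE; apply: mean_le => A; rewrite ler_nat.
case: (boolP (_ \in I)) => //= nI; case: (boolP (_ \in I)) => //= iI.
by move: nI; rewrite (I_incr _ iI)// setUSS// setDS.
Qed.

Lemma fail_in Q E : E \in I -> fail_prob Q E = 0.
Proof.
move=> EI; apply: big1 => A _.
by rewrite (I_incr _ EI) ?subsetUl// mulr0.
Qed.

Lemma fail_query Q E x : x \notin Q ->
  fail_prob Q E = p * fail_prob (x |: Q) (x |: E) + (1 - p) * fail_prob (x |: Q) E.
Proof.
move=> xQ; rewrite {1}/fail_prob (mean_query x); congr (_ * _ + _ * _).
  apply: eq_bigr => A _; congr (_ * (_ \notin I)%:R).
  by apply/setP => y; rewrite !inE; case: eqP => // ->; rewrite (negbTE xQ) orbT.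
apply: eq_bigr => A _; congr (_ * (_ \notin I)%:R).
by apply/setP => y; rewrite !inE negb_or; case: eqP => // ->; rewrite ?andbF.
Qed.

(* The expectation of g under the binomial law of parameters b and p. *)
Fixpoint binom_mean (b : nat) (g : nat -> R) : R :=
  if b is b'.+1 then p * binom_mean b' (fun i => g i.+1) + (1 - p) * binom_mean b' g else g 0%N.

(** The elements of [S] are exposed one at a time by [fail_query]. As [g] sees the outcome [B] only
    through its size, averaging over [B] gives a binomial mean. *)
Lemma fail_reveal Q E S g : [disjoint S & Q] ->
  (forall B, B \subset S -> fail_prob (S :|: Q) (B :|: E) <= g #|B|) ->
  fail_prob Q E <= binom_mean #|S| g.
Proof.
move: {2}#|S| (erefl #|S|) => m; elim: m S Q E g => [|m IH] S Q E g cS dS Hg.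
  rewrite cS /=; move: Hg; rewrite (cards0_eq cS) => /(_ set0 (sub0set _)).
  by rewrite !set0U cards0.
have [x xS] : exists x, x \in S by apply/set0Pn; rewrite -card_gt0 cS.
have cS' : #|S :\ x| = m by move: cS; rewrite (cardsD1 x) xS add1n => -[].
have xQ : x \notin Q by rewrite (disjointFr dS).
have dS' : [disjoint S :\ x & x |: Q].
  rewrite disjoints_subset; apply/subsetP => y; rewrite !inE negb_or => /andP[-> yS].
  by rewrite (disjointFr dS yS).
have eS : (S :\ x) :|: (x |: Q) = S :|: Q by rewrite setUA [_ :|: [set x]]setUC setD1K.
rewrite (fail_query _ xQ) cS -cS' /=; apply: lerD.
  apply: ler_wpM2l => //; apply: IH => // B BS; rewrite eS setUA [_ :|: [set x]]setUC.
  have -> : #|B|.+1 = #|x |: B|.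
    rewrite cardsU1; case: (boolP (x \in B)) => // /(subsetP BS).
    by rewrite !inE eqxx.
  apply: Hg; rewrite subUset sub1set xS/=.
  by apply: subset_trans BS _; apply: subD1set.
apply: ler_wpM2l; first by rewrite subr_ge0.
apply: IH => // B BS; rewrite eS; apply: Hg.
by apply: subset_trans BS _; apply: subD1set.
Qed.

Lemma binom_mean_eq g g' b : g =1 g' -> binom_mean b g = binom_mean b g'.
Proof.
elim: b g g' => [|b IH] g g' gg //=.
by rewrite (IH _ _ gg) (IH (fun i => g i.+1) (fun i => g' i.+1)).
Qed.

Lemma binom_mean_le g g' b : (forall i, (i <= b)%N -> g i <= g' i) -> binom_mean b g <= binom_mean b g'.
Proof.
elim: b g g' => [|b IH] g g' gg /=; first exact: gg.
apply: lerD; apply: ler_wpM2l; rewrite ?subr_ge0//; apply: IH => i ib; apply: gg => //.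
exact: leqW.
Qed.

Lemma binom_meanD g g' b : binom_mean b (fun i => g i + g' i) = binom_mean b g + binom_mean b g'.
Proof.
elim: b g g' => [|b IH] g g' //=.
by rewrite !(IH, IH (fun i => g i.+1)) !mulrDr addrACA.
Qed.

Lemma binom_meanZ c g b : binom_mean b (fun i => c * g i) = c * binom_mean b g.
Proof.
elim: b g => [|b IH] g //=.
by rewrite !(IH, IH (fun i => g i.+1)) mulrDr !(mulrCA c).
Qed.

Lemma binom_mean_cst c b : binom_mean b (fun=> c) = c.
Proof. by elim: b => //= b ->; rewrite -mulrDl addrC subrK mul1r. Qed.

Lemma binom_mean_full b x y : binom_mean b (fun i => if (b <= i)%N then x else y) = p ^+ b * x + (1 - p ^+ b) * y.
Proof.
elim: b => [|b IH]; first by rewrite /= expr0 mul1r subrr mul0r addr0.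
rewrite /= (binom_mean_eq b (g' := fun i => if (b <= i)%N then x else y)) ?IH//.
have -> : binom_mean b (fun i => if (b < i)%N then x else y) = y.
  rewrite -[RHS](binom_mean_cst _ b); apply/eqP; rewrite eq_le.
  by apply/andP; split; apply: binom_mean_le => i ib; rewrite ltnNge ib.
rewrite exprS; set z := p ^+ b; ring.
Qed.

(* The blocks B c are exposed one after the other: each one is entirely present with
   probability at least p ^+ d, whatever the outcome for the previous ones. *)
Lemma fail_blocks (T : eqType) (cs : seq T) (B : T -> {set X}) d Q E beta :
  0 <= beta -> uniq cs ->
  (forall c, c \in cs -> [disjoint B c & Q]) ->
  (forall c c', c \in cs -> c' \in cs -> c != c' -> [disjoint B c & B c']) ->
  (forall c, c \in cs -> (#|B c| <= d)%N) ->
  (forall c, c \in cs -> fail_prob (\bigcup_(c' <- cs) B c' :|: Q) (B c :|: E) <= beta) ->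
  fail_prob Q E <= (1 - p ^+ d) ^+ size cs + beta.
Proof.
move=> beta0; elim: cs Q => [|c cs IH] Q /=.
  move=> _ _ _ _ _; rewrite expr0; apply: le_trans (fail_le1 _ _) _; lra.
case/andP => ccs ucs dQ dB cB Hf.
set y := (1 - p ^+ d) ^+ size cs + beta.
have pd : 0 <= p ^+ d <= 1 by rewrite exprn_ge0// exprn_ile1.
have y0 : 0 <= (1 - p ^+ d) ^+ size cs by rewrite exprn_ge0//; lra.
have step : fail_prob Q E <= binom_mean #|B c| (fun i => if (#|B c| <= i)%N then beta else y).
  apply: fail_reveal => [|A AB]; first by apply: dQ; rewrite mem_head.
  case: ifP => [cA|_].
    have -> : A = B c by apply/eqP; rewrite eqEcard AB.
    apply: le_trans (Hf c (mem_head _ _)); apply: fail_mono => //.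
    by rewrite big_cons -setUA setUS// subsetUr.
  (* An incomplete block is written off: the elements [A] found in it are forgotten, and the
     induction continues with the same [E]. *)
  apply: le_trans (_ : fail_prob (B c :|: Q) E <= _).
    by apply: fail_mono => //; apply: subsetUr.
  apply: IH => //.
  - move=> c' c'cs; rewrite disjoint_sym disjoints_subset subUset -!disjoints_subset.
    rewrite dB ?mem_head ?inE ?c'cs ?orbT//; last by apply: contraNneq ccs => ->.
    by rewrite disjoint_sym dQ// inE c'cs orbT.
  - by move=> c1 c2 h1 h2; apply: dB; rewrite inE ?h1 ?h2 orbT.
  - by move=> c1 h1; apply: cB; rewrite inE h1 orbT.
  - move=> c1 h1; have := Hf c1; rewrite inE h1 orbT => /(_ isT).
    by rewrite big_cons setUA [_ :|: B c]setUC.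
apply: le_trans step _; rewrite binom_mean_full exprS.
have : p ^+ d <= p ^+ #|B c| by rewrite ler_wiXn2l// cB// mem_head.
have : p ^+ #|B c| <= 1 by rewrite exprn_ile1.
move: (p ^+ #|B c|) => r r1 rd.
(* With [r] the probability that the block is complete, the mean equals [(1 - r) * z + beta], and
   [q <= r]. *)
rewrite /y; move: pd y0; set q := p ^+ d in rd *; set z := _ ^+ _ => /andP[q0 q1] z0.
have : 0 <= (r - q) * z by rewrite mulr_ge0// subr_ge0.
lra.
Qed.

(** * Upper tails of the binomial law *)

Definition tail b a : R := binom_mean b (fun i => (a <= i)%N%:R).

Lemma tailS b a : tail b.+1 a.+1 = p * tail b a + (1 - p) * tail b a.+1.
Proof. by []. Qed.

Lemma tail0 b : tail b 0 = 1.
Proof. exact: binom_mean_cst. Qed.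

Lemma tail_ge0 b a : 0 <= tail b a.
Proof. by rewrite -[leLHS](binom_mean_cst 0 b); apply: binom_mean_le. Qed.

Lemma tail_le1 b a : tail b a <= 1.
Proof. by rewrite -[leRHS](binom_mean_cst 1 b); apply: binom_mean_le => i _; case: (_ <= _)%N. Qed.

Lemma tail_antia b a : tail b a.+1 <= tail b a.
Proof.
apply: binom_mean_le => i _; rewrite ler_nat.
by case: (ltnP a i) => // /ltnW ->.
Qed.

Lemma tail_mono b t a : tail b a <= tail (t + b) a.
Proof.
elim: t => [|t IH] //; apply: le_trans IH _; rewrite addSn.
case: a => [|a]; first by rewrite !tail0.
rewrite tailS; have := tail_antia (t + b) a; move: (tail _ _) (tail _ _) => x y.
move=> xy; have : 0 <= p * (x - y) by rewrite mulr_ge0// subr_ge0.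
lra.
Qed.

(** It suffices to have one success among [t] extra trials and [a] successes among the other [b]. *)
Lemma tail_add b t a : (1 - (1 - p) ^+ t) * tail b a <= tail (t + b) a.+1.
Proof.
elim: t => [|t IH]; first by rewrite expr0 subrr mul0r tail_ge0.
rewrite addSn tailS.
have h1 : p * tail b a <= p * tail (t + b) a by rewrite ler_wpM2l ?tail_mono.
have h2 : (1 - p) * ((1 - (1 - p) ^+ t) * tail b a) <= (1 - p) * tail (t + b) a.+1.
  by rewrite ler_wpM2l// subr_ge0.
apply: le_trans (lerD h1 h2); rewrite exprS le_eqVlt; apply/orP; left; apply/eqP.
move: ((1 - p) ^+ t) (tail b a) => u v; ring.
Qed.

(** Split the trials into [a] groups of [t] and ask for a success in each group. *)
Lemma tail_mul t a : (1 - (1 - p) ^+ t) ^+ a <= tail (a * t) a.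
Proof.
elim: a => [|a IH]; first by rewrite expr0 tail0.
rewrite exprS mulSn; apply: le_trans (tail_add _ _ _).
by rewrite ler_wpM2l// subr_ge0 exprn_ile1// ?subr_ge0// lerBlDr lerDl.
Qed.

(** This is Markov's inequality for [2 ^ (- X)] with [X] binomial, whose mean is [(1 - p / 2) ^+ b],
    carried out by induction on [b]. *)
Lemma tail_chernoff b a : 1 - tail b a <= 2 ^+ a * (1 - p / 2) ^+ b.
Proof.
have h : 0 <= 1 - p / 2 by rewrite subr_ge0 ler_pdivrMr ?mul1r ?(le_trans p1) ?ler1n ?ltr0n.
elim: b a => [|b IH] [|a].
- by rewrite tail0 subrr mulr_ge0// exprn_ge0.
- by rewrite /tail /= subr0 expr0 mulr1 exprn_ege1// ler1n.
- by rewrite tail0 subrr mulr_ge0// ?exprn_ge0.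
have h1 : p * (1 - tail b a) <= p * (2 ^+ a * (1 - p / 2) ^+ b) by rewrite ler_wpM2l.
have h2 : (1 - p) * (1 - tail b a.+1) <= (1 - p) * (2 ^+ a.+1 * (1 - p / 2) ^+ b).
  by rewrite ler_wpM2l// subr_ge0.
rewrite tailS; have := lerD h1 h2; rewrite !exprS.
move: (2 ^+ a) (_ ^+ b) (tail _ _) (tail _ _) => u v w z; lra.
Qed.

End ProductMeasure.

(** * Thresholds and coupling *)

Lemma leq_card_bigcup (I T : finType) (A : {set I}) (B : I -> {set T}) k :
  (forall i, i \in A -> (#|B i| <= k)%N) -> (#|\bigcup_(i in A) B i| <= #|A| * k)%N.
Proof.
move=> Bk; rewrite -sum_nat_const; elim/big_rec2: _ => [|i m C iA IH]; first by rewrite cards0.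
by apply: leq_trans (leq_card_setU _ _) _; rewrite leq_add// Bk.
Qed.

Section Thresholds.
Variables (R : realType) (X : finType).
Implicit Types (p : R) (I D : {set {set X}}) (k : nat).

Lemma k_threshold_le p k I : 0 <= p <= 1 ->
  (forall D, decreasing_family D -> mu p D >= 1 - (2 * k%:R)^-1 ->
     k_unions k D :&: I != set0) ->
  k_threshold R k I <= p.
Proof. by move=> p01 H; apply: ge_inf => //; exists 0 => x [/andP[]]. Qed.

Lemma expectation_threshold_ge p I : 0 <= p <= 1 -> p_small p I ->
  p <= expectation_threshold R I.
Proof. by move=> p01 H; apply: ub_le_sup => //; exists 1 => x [/andP[]]. Qed.

Lemma mem_k_unions k D (J : finType) (F : J -> {set X}) : #|J| = k ->
  (forall j, F j \in D) -> \bigcup_j F j \in k_unions k D.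
Proof.
move=> cJ FD; pose h (i : 'I_k) : J := enum_val (cast_ord (esym cJ) i).
apply/imsetP; exists [ffun i => F (h i)].
  by apply/ffun_onP => i; rewrite ffunE.
have hb : bijective h.
  exists (fun j => cast_ord cJ (enum_rank j)) => [i|j].
    by rewrite /h enum_valK cast_ordKV.
  by rewrite /h cast_ordK enum_rankK.
by rewrite (reindex h) /=; [apply: eq_bigr => i _; rewrite ffunE | exact: onW_bij].
Qed.

(** At [p = 1] all the mass sits on the full set, which therefore belongs to every [D] of positive
    measure. *)
Lemma k_threshold_le1 k I : (0 < k)%N -> setT \in I -> k_threshold R k I <= 1.
Proof.
move=> k0 TI; apply: k_threshold_le; first by rewrite ler01 lexx.
move=> D _ muD; have TD : setT \in D.
  case: (boolP (setT \in D)) => // TD; suff : mu (1 : R) D = 0.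
    move=> D0; move: muD; rewrite D0 subr_le0 invf_ge1 ?mulr_gt0 ?ltr0n//.
    move=> h; have : (2 * 1%:R : R) <= 2 * k%:R by rewrite ler_wpM2l// ler_nat.
    by move: h; rewrite -natrM; lra.
  apply: big1 => A AD; rewrite subrr expr0n.
  case: eqP => [/cards0_eq A0|_]; last by rewrite mulr0.
  by move: TD; rewrite -(setCK setT) setCT -A0 setCK AD.
apply/set0Pn; exists setT; rewrite inE TI andbT.
have := @mem_k_unions k D 'I_k (fun=> setT) (card_ord k) (fun=> TD).
suff -> : \bigcup_(j < k) (fun=> setT) j = setT :> {set X} by [].
apply/setP => x; rewrite !inE; apply/bigcupP.
by exists (Ordinal k0); rewrite ?inE.
Qed.

Lemma p_small_le p I (G : {set {set X}}) m : 0 <= p <= 1 ->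
  (forall S, S \in G -> #|S| = m) ->
  (forall A, A \in I -> exists2 S, S \in G & S \subset A) ->
  #|G|%:R * p ^+ m <= 2^-1 -> p_small p I.
Proof.
move=> /andP[p0 p1] Gm GI H; exists G; split.
  apply/subsetP => A /GI[S SG SA]; apply/bigcupP; exists S => //.
  by rewrite inE.
rewrite (eq_bigr (fun=> p ^+ m)).
  by apply: le_trans H; rewrite sumr_const mulr_natl.
by move=> S SG; rewrite mu_up_set// Gm.
Qed.

(* If A contains a copy of F j and a g @: A is in D, then a translate of F j by a
   group element, uniform when g is, is in D; so, for a random g, the set
   a g @: F j is outside D with probability less than 1 / #|J|. *)
Lemma coupling (gT : finGroupType) (a : gT -> {perm X}) (J : finType)
    (F : J -> {set X}) p D :
  {morph a : g h / (g * h)%g} -> 0 <= p <= 1 -> (0 < #|J|)%N ->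
  (forall j, mu p [set A : {set X} | [exists g, a g @: F j \subset A]] > 1 - (2 * #|J|%:R)^-1) ->
  decreasing_family D -> mu p D >= 1 - (2 * #|J|%:R)^-1 ->
  exists g, forall j, a g @: F j \in D.
Proof.
move=> aM /andP[p0 p1] J0 HF decD muD.
pose bad j := [set g | a g @: F j \notin D].
have imM g h (A : {set X}) : a (g * h)%g @: A = a h @: (a g @: A).
  by rewrite -imset_comp; apply: eq_imset => x; rewrite /= aM permM.
have key j : #|bad j|%:R < #|gT|%:R / #|J|%:R :> R.
  pose Good := [set A : {set X} | [exists g, a g @: F j \subset A]].
  pose N (A : {set X}) := #|[set g | a g @: A \in D]|.
  pose c := #|[set g | a g @: F j \in D]|.
  (* Double counting: each [a g] permutes the ground set and so preserves the weights. *)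
  have sumN : mean p (fun A => (N A)%:R) = #|gT|%:R * mu p D.
    rewrite mu_mean /mean.
    transitivity (\sum_A \sum_g set_weight p A * (a g @: A \in D)%:R).
      apply: eq_bigr => A _; rewrite -mulr_sumr; congr (_ * _).
      rewrite -natr_sum; congr _%:R; rewrite /N -sum1dep_card big_mkcond/=.
      by apply: eq_bigr => g _; case: ifP.
    rewrite exchange_big/=.
    transitivity (\sum_(g : gT) \sum_A set_weight p A * (A \in D)%:R).
      apply: eq_bigr => g _.
      have ginj : injective (fun A : {set X} => a g @: A) by apply: imset_inj; exact: perm_inj.
      rewrite [RHS](reindex_inj ginj)/=; apply: eq_bigr => A _; congr (_ * _).
      rewrite /set_weight; have -> : ~: (a g @: A) = a g @: (~: A).
        apply/eqP; rewrite eqEcard; apply/andP; split.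
          apply/subsetP => x; rewrite inE => xA; apply/imsetP.
          exists ((a g)^-1 x)%g; last by rewrite permKV.
          by rewrite inE; apply: contra xA => h; rewrite -(permKV (a g) x) imset_f.
        rewrite card_imset; last exact: perm_inj.
        by rewrite cardsCs setCK [#|~: (_ @: _)|]cardsCs setCK card_imset//; exact: perm_inj.
      by rewrite !card_imset//; exact: perm_inj.
    by rewrite sumr_const mulr_natl.
  (* If [A] contains [a h @: F j], left multiplication by [h] injects the [g] with [a g @: A] in [D]
     into those counted by [c], as [D] is decreasing. Otherwise the trivial bound [#|gT|] is
     used. *)
  have NA A : (N A)%:R <= c%:R + #|gT|%:R * (1 - (A \in Good)%:R) :> R.
    case: (boolP (A \in Good)) => [|_].
      rewrite inE => /existsP[h hA]; rewrite subrr mulr0 addr0 ler_nat.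
      rewrite /N -(card_imset _ (mulgI h)); apply: subset_leq_card.
      apply/subsetP => _ /imsetP[g gD ->]; move: gD; rewrite !inE imM.
      by apply: decD; apply: imsetS.
    rewrite subr0 mulr1; apply: le_trans (_ : #|gT|%:R <= _).
      by rewrite ler_nat max_card.
    by rewrite lerDr ler0n.
  have : #|gT|%:R * mu p D <= c%:R + #|gT|%:R * (1 - mu p Good).
    rewrite -sumN; apply: le_trans (mean_le p0 p1 NA) _.
    rewrite mu_mean; pose g (A : {set X}) : R := (A \in Good)%:R.
    rewrite /mean -/g.
    change (\sum_A set_weight p A * (c%:R + #|gT|%:R * (1 - g A)) <=
            c%:R + #|gT|%:R * (1 - \sum_A set_weight p A * g A)).
    rewrite le_eqVlt; apply/orP; left; apply/eqP; have E1 := @set_weight_sum1 R X p.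
    rewrite -[X in _ * (X - _)]E1 -[X in X + _]mulr1 -[X in _ * X + _]E1.
    rewrite -sumrB !mulr_sumr -big_split/=; apply: eq_bigr => A _.
    by move: (g A) => y; ring.
  have cb : #|bad j|%:R = #|gT|%:R - c%:R :> R.
    have -> : bad j = ~: [set g | a g @: F j \in D] by apply/setP => g; rewrite !inE.
    by rewrite -(cardsC [set g | a g @: F j \in D]) natrD -/c [c%:R + _]addrC addrK.
  have gT0 : 0 < #|gT|%:R :> R by rewrite ltr0n; apply/card_gt0P; exists 1%g.
  have := HF j; rewrite -/Good cb; move: muD; rewrite invfM.
  move: (mu p D) (mu p Good) gT0 => x y; move: #|gT|%:R c%:R (_^-1 : R) => t u v t0.
  move=> h1 h2 h3; have : 0 < t * (y - (1 - 2^-1 * v)) by rewrite mulr_gt0// subr_gt0.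
  have : 0 <= t * (x - (1 - 2^-1 * v)) by rewrite mulr_ge0 ?subr_ge0// ltW.
  lra.
(* Union bound over [j]: some [g] avoids all the sets [bad j]. *)
have : #|\bigcup_j bad j|%:R < #|gT|%:R :> R.
  apply: le_lt_trans (_ : (\sum_j #|bad j|)%:R < _).
    rewrite ler_nat; elim/big_rec2: _ => [|i m A _ IH]; first by rewrite cards0.
    by apply: leq_trans (leq_card_setU _ _) _; rewrite leq_add2l.
  rewrite natr_sum; apply: lt_le_trans (_ : \sum_(j : J) #|gT|%:R / #|J|%:R <= _).
    have [j0 _] := card_gt0P J0.
    rewrite (bigD1 j0)//= [ltRHS](bigD1 j0)//=; apply: ltr_leD => //.
    by apply: ler_sum => j _; apply: ltW.
  by rewrite sumr_const -[leLHS]mulr_natr divfK// pnatr_eq0 -lt0n.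
rewrite ltr_nat => lt; have : ~: (\bigcup_j bad j) != set0.
  rewrite -card_gt0; move: lt; rewrite -(cardsC (\bigcup_j bad j)); lia.
case/set0Pn => g; rewrite inE => gb; exists g => j.
by apply: contraNT gb => gj; apply/bigcupP; exists j; rewrite ?inE.
Qed.

End Thresholds.

(** * Graph embeddings *)

(** Vertices are treated one at a time: composing with a transposition sends [x] to its target, and
    injectivity ensures that the earlier vertices are not moved. *)
Lemma perm_extension (V T : finType) (i f : V -> T) (U : {set V}) :
  injective i -> {in U &, injective f} ->
  exists r : {perm T}, forall v, v \in U -> r (i v) = f v.
Proof.
move=> iinj; move: {2}#|U| (erefl #|U|) => m; elim: m U => [|m IH] U cU finj.
  by exists 1%g => v; rewrite (cards0_eq cU) inE.
have [x xU] : exists x, x \in U by apply/set0Pn; rewrite -card_gt0 cU.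
have cU' : #|U :\ x| = m by move: cU; rewrite (cardsD1 x) xU add1n => -[].
have [|r Hr] := IH _ cU'.
  by move=> u v /setD1P[_ uU] /setD1P[_ vU]; apply: finj.
exists (r * tperm (r (i x)) (f x))%g => v vU; rewrite permM.
have [->|vx] := eqVneq v x; first by rewrite tpermL.
have vU' : v \in U :\ x by rewrite !inE vx.
rewrite (Hr v vU') tpermD//.
  by rewrite -(Hr v vU') (inj_eq perm_inj) (inj_eq iinj) eq_sym.
by apply: contra_neq vx => /finj->.
Qed.

Section Adjacency.
Variable V : finType.
Implicit Types (H F : graph V) (x y : V).

Lemma adjP H x y : reflect (exists2 e, e \in H & val e = [set x; y]) (adj H x y).
Proof.
apply: (iffP existsP) => [[e /andP[eH /eqP ee]]|[e eH ee]]; exists e => //.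
by rewrite eH ee eqxx.
Qed.

Lemma vpairP (e : vpair V) : exists x y, x != y /\ val e = [set x; y].
Proof. by apply/cards2P; exact: (valP e). Qed.

Lemma adj_sym H x y : adj H x y = adj H y x.
Proof. by rewrite /adj setUC. Qed.

Lemma adj_neq H x y : adj H x y -> x != y.
Proof.
case/adjP => e _ ee; apply/eqP => xy; have := valP e.
by rewrite ee xy setUid cards1.
Qed.

Lemma adj_val H (e : vpair V) x y : val e = [set x; y] -> adj H x y = (e \in H).
Proof.
move=> ee; apply/adjP/idP => [[e' e'H e'e]|eH]; last by exists e.
suff -> : e = e' by [].
by apply: val_inj; rewrite e'e.
Qed.

Lemma adj_subset F H x y : F \subset H -> adj F x y -> adj H x y.
Proof. by move=> /subsetP FH /adjP[e eF ee]; apply/adjP; exists e => //; apply: FH. Qed.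

Lemma adj_exists x y : x != y -> exists e : vpair V, val e = [set x; y].
Proof.
move=> xy; have c : #|[set x; y]| == 2%N by rewrite cards2 xy.
by exists (Sub [set x; y] c); rewrite SubK.
Qed.

Lemma adjU F H x y : adj (F :|: H) x y = adj F x y || adj H x y.
Proof.
apply/adjP/orP => [[e]|[]/adjP[e eF ee]].
- by rewrite inE => /orP[eF|eF] ee; [left|right]; apply/adjP; exists e.
- by exists e; rewrite // inE eF.
- by exists e; rewrite // inE eF orbT.
Qed.

End Adjacency.

Section Embeddings.
Variables V W : finType.
Implicit Types (H F : graph V) (G A : graph W) (f : V -> W).

Definition embeds F A := [exists f : {ffun V -> W}, injectiveb f &&
  [forall x, forall y, adj F x y ==> adj A (f x) (f y)]].

Lemma embedsP F A : reflect (exists2 f : V -> W, injective f &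
  forall x y, adj F x y -> adj A (f x) (f y)) (embeds F A).
Proof.
apply: (iffP existsP) => [[f /andP[/injectiveP finj H]]|[f finj H]].
  by exists f => // x y xy; move: H => /forallP/(_ x)/forallP/(_ y)/implyP; apply.
exists [ffun x => f x]; apply/andP; split.
  by apply/injectiveP => x y; rewrite !ffunE => /finj.
by apply/forallP => x; apply/forallP => y; apply/implyP; rewrite !ffunE; apply: H.
Qed.

Lemma embeds_subset F A A' : A \subset A' -> embeds F A -> embeds F A'.
Proof.
move=> AA' /embedsP[f finj H]; apply/embedsP; exists f => // x y /H.
exact: adj_subset.
Qed.

(** Only the images of non-isolated vertices matter: the map is extended from [U] by a permutation
    of [W], and [i] witnesses that [W] is large enough. *)
Lemma embeds_partial F A (i f : V -> W) (U : {set V}) : injective i ->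
  (forall x y, adj F x y -> x \in U) -> {in U &, injective f} ->
  (forall x y, adj F x y -> adj A (f x) (f y)) -> embeds F A.
Proof.
move=> iinj FU finj H; have [r Hr] := perm_extension iinj finj.
apply/embedsP; exists (r \o i) => [|x y xy]; first exact: inj_comp perm_inj iinj.
have yx : adj F y x by rewrite adj_sym.
by rewrite /= (Hr x (FU x y xy)) (Hr y (FU y x yx)); apply: H.
Qed.

Definition img f F : graph W :=
  [set e : vpair W | [exists e0 in F, val e == f @: val e0]].

Lemma adj_img f F x y : injective f -> adj (img f F) (f x) (f y) = adj F x y.
Proof.
move=> finj; apply/adjP/adjP => [[e]|[e eF ee]].
  rewrite inE => /existsP[e0 /andP[e0F /eqP e1]] e2; exists e0 => //.
  by apply: (imset_inj finj); rewrite -e1 e2 imsetU1 imset_set1.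
have xy : x != y by apply: (@adj_neq _ F); rewrite (adj_val F ee).
have [e' e'e] := @adj_exists _ (f x) (f y) (contra_neq (finj x y) xy).
exists e' => //; rewrite inE; apply/existsP; exists e.
by rewrite eF e'e ee imsetU1 imset_set1 eqxx.
Qed.

Lemma img_subset f F A : injective f ->
  (img f F \subset A) = [forall x, forall y, adj F x y ==> adj A (f x) (f y)].
Proof.
move=> finj; apply/idP/idP => [FA|FA].
  apply/forallP => x; apply/forallP => y; apply/implyP => xy.
  by apply: adj_subset FA _; rewrite adj_img.
apply/subsetP => e; rewrite inE => /existsP[e0 /andP[e0F /eqP e1]].
have [x [y [xy e0e]]] := vpairP e0.
have e2 : val e = [set f x; f y] by rewrite e1 e0e imsetU1 imset_set1.
rewrite -(adj_val A e2); move/forallP/(_ x)/forallP/(_ y)/implyP: FA; apply.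
by rewrite (adj_val F e0e).
Qed.

Lemma card_img f F : injective f -> #|img f F| = #|F|.
Proof.
move=> finj.
have pr (e : vpair V) : #|f @: val e| == 2%N by rewrite card_imset// (valP e).
pose g (e : vpair V) : vpair W := Sub (f @: val e) (pr e).
have -> : img f F = g @: F.
  apply/setP => e; rewrite inE; apply/existsP/imsetP => [[e0 /andP[e0F /eqP ee]]|[e0 e0F ->]].
    by exists e0 => //; apply: val_inj; rewrite ee SubK.
  by exists e0; rewrite e0F SubK eqxx.
rewrite card_imset// => e1 e2 /(congr1 val); rewrite !SubK => /(imset_inj finj).
exact: val_inj.
Qed.

(** An injective map preserving adjacency is an isomorphism onto its image graph [img f H], which is
    a subgraph of [G]. *)
Lemma contains_copyE H G : contains_copy H G = embeds H G.
Proof.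
apply/existsP/embedsP => [[U /existsP[F /andP[/andP[FG _]]]]|[f finj HG]].
  case/existsP => f /and3P[/injectiveP finj _ /forallP Hf]; exists f => // x y xy.
  by apply: adj_subset FG _; move/(_ x)/forallP/(_ y)/eqP: Hf => ->.
exists [set f x | x : V]; apply/existsP; exists (img f H); apply/andP; split.
  apply/andP; split.
    rewrite img_subset//; apply/forallP => x; apply/forallP => y.
    by apply/implyP; apply: HG.
  apply/forallP => e; apply/implyP; rewrite inE => /existsP[e0 /andP[_ /eqP ->]].
  by apply: imsetS; apply/subsetP => x _; rewrite inE.
apply/existsP; exists [ffun x => f x]; apply/and3P; split.
- by apply/injectiveP => x y; rewrite !ffunE => /finj.
- apply/eqP/setP => w; apply/imsetP/imsetP => -[x _ ->]; exists x => //; by rewrite ffunE.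
- by apply/forallP => x; apply/forallP => y; rewrite !ffunE adj_img.
Qed.

End Embeddings.

(** * Action of vertex permutations on edges *)

Section PermAction.
Variable W : finType.
Implicit Types (s t : {perm W}) (A : graph W).

Lemma vpair_perm_subproof s (e : vpair W) : #|s @: val e| == 2%N.
Proof. by rewrite card_imset; [exact: (valP e) | exact: perm_inj]. Qed.

Definition vpair_map s (e : vpair W) : vpair W := Sub (s @: val e) (vpair_perm_subproof s e).

Lemma vpair_map_inj s : injective (vpair_map s).
Proof.
move=> e1 e2 /(congr1 val); rewrite !SubK => /imset_inj h.
by apply: val_inj; apply: h; exact: perm_inj.
Qed.

Definition vpair_perm s : {perm vpair W} := perm (@vpair_map_inj s).

Lemma vpair_permM : {morph vpair_perm : s t / (s * t)%g}.
Proof.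
move=> s t; apply/permP => e; rewrite permM !permE; apply: val_inj.
by rewrite !SubK -imset_comp; apply: eq_imset => x; rewrite /= permM.
Qed.

Lemma adj_vpair_perm s A x y : adj (vpair_perm s @: A) (s x) (s y) = adj A x y.
Proof.
apply/adjP/adjP => [[_ /imsetP[e eA ->]]|[e eA ee]].
  rewrite permE SubK => h; exists e => //.
  by apply: (imset_inj (@perm_inj _ s)); rewrite h imsetU1 imset_set1.
exists (vpair_perm s e); first exact: imset_f.
by rewrite permE SubK ee imsetU1 imset_set1.
Qed.

End PermAction.

(** * Bounding the two thresholds of a graph *)

Section GraphThresholdBounds.
Variables (R : realType) (V : finType) (n : nat) (H : graph V).
Implicit Types (F : graph V) (p : R).

Definition hosts F : {set graph 'I_n} := [set A | embeds F A].

Lemma hosts_incr F (A B : graph 'I_n) : A \subset B -> A \in hosts F -> B \in hosts F.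
Proof. by move=> AB; rewrite !inE; apply: embeds_subset. Qed.

Lemma containingE : containing n H = hosts H.
Proof. by apply/setP => A; rewrite !inE contains_copyE. Qed.

Hypothesis Vn : (#|V| <= n)%N.

(** A reference placement of the vertices in [n], of which every other placement is a
    relabelling. *)
Let iota_ (v : V) : 'I_n := widen_ord Vn (enum_rank v).

Let iota_inj : injective iota_.
Proof. by move=> u v /(congr1 val)/= /val_inj/enum_rank_inj. Qed.

Lemma hosts_partial F (A : graph 'I_n) (f : V -> 'I_n) (U : {set V}) :
  (forall x y, adj F x y -> x \in U) -> {in U &, injective f} ->
  (forall x y, adj F x y -> adj A (f x) (f y)) -> A \in hosts F.
Proof. by move=> *; rewrite inE; apply: embeds_partial iota_inj _ _ _; eauto. Qed.

(** [coupling] is applied to the symmetric group on [n] acting on pairs, and to the pieces placed by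
    [iota_]. *)
Lemma threshold_pieces (J : finType) (F : J -> graph V) p : 0 <= p <= 1 ->
  (0 < #|J|)%N -> H \subset \bigcup_j F j ->
  (forall j, mu p (hosts (F j)) > 1 - (2 * #|J|%:R)^-1) ->
  k_threshold R #|J| (containing n H) <= p.
Proof.
move=> p01 J0 HF muF; apply: k_threshold_le => // D decD muD.
have [|g Hg] := coupling (F := fun j => img iota_ (F j)) (@vpair_permM _) p01 J0 _ decD muD.
  move=> j; apply: lt_le_trans (muF j) _; rewrite !mu_mean; case/andP: p01 => p0 p1.
  apply: mean_le => // A; rewrite ler_nat; case: (boolP (A \in hosts _)) => //.
  rewrite inE => /embedsP[f finj Hf]; rewrite inE.
  have [r Hr] := @perm_extension _ _ _ f setT iota_inj (in2W finj).
  suff -> : [exists g, vpair_perm g @: img iota_ (F j) \subset A] by [].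
  apply/existsP; exists r; apply/subsetP => _ /imsetP[e eF ->].
  move: eF; rewrite inE => /existsP[e0 /andP[e0F /eqP e1]].
  have [x [y [xy e0e]]] := vpairP e0.
  rewrite -(adj_val A (x := f x) (y := f y)); first by apply: Hf; rewrite (adj_val _ e0e).
  by rewrite permE SubK e1 e0e !imsetU1 !imset_set1 !Hr.
(* All pieces are moved by the same [g], so together they contain the copy [g \o iota_] of [H]. *)
apply/set0Pn; exists (\bigcup_j vpair_perm g @: img iota_ (F j)); rewrite inE.
rewrite (mem_k_unions _ Hg)//= containingE inE; apply/embedsP; exists (g \o iota_).
  exact: inj_comp perm_inj iota_inj.
move=> x y /adjP[e eH ee]; have /bigcupP[j _ ej] := subsetP HF _ eH.
apply: (@adj_subset _ (vpair_perm g @: img iota_ (F j))).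
  by apply/subsetP => z zj; apply/bigcupP; exists j.
by rewrite /= adj_vpair_perm adj_img// (adj_val _ ee).
Qed.

Lemma threshold_le1 k : (0 < k)%N -> k_threshold R k (containing n H) <= 1.
Proof.
move=> k0; apply: k_threshold_le1 => //; rewrite containingE inE.
apply/embedsP; exists iota_ => // x y xy.
have [e ee] := @adj_exists _ (iota_ x) (iota_ y) (contra_neq (@iota_inj x y) (adj_neq xy)).
by rewrite (adj_val _ ee) inE.
Qed.

(** Graphs are collected rather than maps, so that embeddings with the same image count once; the
    estimate for star forests relies on this. *)
Definition copies F : {set graph 'I_n} :=
  [set img (f : {ffun V -> 'I_n}) F | f in [pred f : {ffun V -> 'I_n} | injectiveb f]].

(** First moment: every graph containing [H] contains a copy of its subgraph [F], so the copies of
    [F] form a cover. *)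
Lemma expectation_threshold_copies F p : F \subset H -> 0 <= p <= 1 ->
  #|copies F|%:R * p ^+ #|F| <= 2^-1 -> p <= expectation_threshold R (containing n H).
Proof.
move=> FH p01 hp; apply: expectation_threshold_ge => //.
apply: (p_small_le (G := copies F) (m := #|F|)) => //.
  by move=> S /imsetP[f /injectiveP finj ->]; rewrite card_img.
move=> A; rewrite containingE inE => /existsP[f /andP[/injectiveP finj Hf]].
exists (img f F); first by apply: imset_f; apply/injectiveP.
rewrite img_subset//; apply/forallP => x; apply/forallP => y; apply/implyP => xy.
by move/forallP/(_ x)/forallP/(_ y)/implyP: Hf; apply; apply: adj_subset FH _.
Qed.

End GraphThresholdBounds.

(** * Greedy embedding *)

Lemma set2_cases (T : finType) (x y a b : T) : [set x; y] = [set a; b] ->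
  (x = a /\ y = b) \/ (x = b /\ y = a).
Proof.
move=> h.
have ha : a \in [set x; y] by rewrite h set21.
have hb : b \in [set x; y] by rewrite h set22.
have hx : x \in [set a; b] by rewrite -h set21.
have hy : y \in [set a; b] by rewrite -h set22.
move: ha hb hx hy; rewrite !inE.
by do 4!(case/orP => /eqP ?); subst; auto.
Qed.

Section GreedyEmbedding.
Variables (R : realType) (p : R) (V : finType) (n d Delta s : nat).
Variables (P : V -> {set V}) (rank : V -> nat) (F : graph V) (U : {set V}).
Hypotheses (p0 : 0 <= p) (p1 : p <= 1) (Vn : (#|V| <= n)%N).
Hypotheses (P_rank : forall u v, u \in P v -> (rank u < rank v)%N)
  (FP : forall x y, adj F x y -> x \in P y \/ y \in P x)
  (PU : forall u v, u \in P v -> u \in U /\ v \in U)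
  (P_card : forall v, (#|P v| <= d)%N)
  (P_deg : forall u, (#|[set v | u \in P v]| <= Delta)%N)
  (room : (#|U| + d * (s * Delta) + s <= n)%N).

(** Bound on the probability that all [s] candidates for one vertex fail. *)
Let eta : R := (1 - p ^+ d) ^+ s.

Let step_set f v (w : 'I_n) : graph 'I_n :=
  [set e | [exists u in P v, val e == [set f u; w]]].

Let step_setP f v (w : 'I_n) e :
  reflect (exists2 u, u \in P v & val e = [set f u; w]) (e \in step_set f v w).
Proof.
rewrite inE; apply: (iffP existsP) => [[u /andP[uP /eqP h]]|[u uP h]]; exists u => //.
by rewrite uP h eqxx.
Qed.

(** Induction on the number of vertices still to embed. [W] is embedded by [f], the pairs of [Q] are
    exposed and those of [E] known to be present. The invariants say that every exposed pair meets
    the image, and that an embedded [u] has at most [s] exposed pairs leaving the image for each of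
    its embedded children. *)
Let greedy_step m Q E (W : {set V}) (f : V -> 'I_n) : #|U :\: W| = m ->
  W \subset U ->
  (forall x u, x \in U -> u \in W -> (rank x < rank u)%N -> x \in W) ->
  {in W &, injective f} ->
  (forall u v, v \in W -> u \in P v -> adj E (f u) (f v)) ->
  (forall x y, adj Q x y -> x \in f @: W \/ y \in f @: W) ->
  (forall u, u \in W -> (#|[set w | (w \notin f @: W) && adj Q (f u) w]| <=
     s * #|[set v in W | u \in P v]|)%N) ->
  fail_prob p (hosts n F) Q E <= m%:R * eta.
Proof.
elim: m Q E W f => [|m IH] Q E W f cW WU down finj HE HQ1 HQ2.
  have UW : U \subset W by rewrite -setD_eq0 -cards_eq0 cW.
  rewrite mul0r (fail_in p (@hosts_incr _ _ F))//.
  apply: (hosts_partial Vn (f := f) (U := W)) => // x y /FP.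
    by case=> /PU[h1 h2]; apply: (subsetP UW).
  case=> xy; first by apply: HE => //; apply: (subsetP UW); case: (PU xy).
  by rewrite adj_sym; apply: HE => //; apply: (subsetP UW); case: (PU xy).
have [v0 v0U] : exists v0, v0 \in U :\: W by apply/set0Pn; rewrite -card_gt0 cW.
(* An unembedded vertex of least rank has all its parents embedded. *)
case: (arg_minnP rank v0U) => v vU vmin.
have {vU} /setDP[vU vW] : v \in U :\: W := vU.
have vdown x : x \in U -> (rank x < rank v)%N -> x \in W.
  move=> xU xv; apply: contraLR xv => xW; rewrite -leqNgt; apply: vmin.
  by apply/setDP.
have PW u : u \in P v -> u \in W by move=> uv; apply: vdown; [case: (PU uv) | exact: P_rank].
have fW u : u \in W -> f u \in f @: W by exact: imset_f.
(* Vertices already used, or already tested against the image of a parent of [v]. By [room], at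
   least [s] candidates lie outside. *)
pose Bad := f @: W :|: \bigcup_(u in P v) [set w | (w \notin f @: W) && adj Q (f u) w].
have cBad : (#|Bad| <= #|U| + d * (s * Delta))%N.
  apply: leq_trans (leq_card_setU _ _) _; apply: leq_add.
    by apply: leq_trans (leq_imset_card _ _) _; apply: subset_leq_card.
  apply: leq_trans (_ : #|P v| * (s * Delta) <= _)%N; last by rewrite leq_mul2r P_card orbT.
  rewrite -sum_nat_const; elim/big_rec2: _ => [|u k A uP IHA]; first by rewrite cards0.
  apply: leq_trans (leq_card_setU _ _) _; rewrite leq_add//.
  apply: leq_trans (HQ2 _ (PW _ uP)) _; rewrite leq_mul2l; apply/orP; right.
  apply: leq_trans (P_deg u); apply: subset_leq_card; apply/subsetP => x.
  by rewrite !inE => /andP[].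
pose cs := take s (enum (~: Bad)).
have size_cs : size cs = s.
  rewrite size_takel// -cardE; move: (cardsC Bad); rewrite card_ord; lia.
have csBad c : c \in cs -> c \notin Bad.
  by move=> /mem_take; rewrite mem_enum inE.
have csW c : c \in cs -> c \notin f @: W.
  by move=> /csBad; apply: contra => h; rewrite inE h.
have ucs : uniq cs by rewrite take_uniq// enum_uniq.
rewrite -natr1 mulrDl mul1r addrC /eta -[X in _ ^+ X + _]size_cs.
apply: (fail_blocks p0 p1 (@hosts_incr _ _ F) (B := step_set f v)) => //.
- by rewrite mulr_ge0// exprn_ge0// subr_ge0 exprn_ile1.
- move=> c ccs; rewrite disjoint_subset; apply/subsetP => e /step_setP[u uP ee].
  rewrite inE; apply: contra (csBad _ ccs) => eQ; rewrite inE; apply/orP; right.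
  by apply/bigcupP; exists u => //; rewrite inE csW//= (adj_val _ ee).
(* A tested pair determines its candidate, the only endpoint outside [f @: W]. *)
- move=> c c' ccs c'cs cc'; rewrite disjoint_subset; apply/subsetP => e /step_setP[u uP ee].
  rewrite inE; apply/negP => /step_setP[u' u'P]; rewrite ee => /set2_cases[[_ h]|[h _]].
    by rewrite h eqxx in cc'.
  by have := csW _ c'cs; rewrite -h fW// PW.
- move=> c ccs; apply: leq_trans (P_card v); rewrite -(card_imset _ val_inj).
  apply: leq_trans (leq_imset_card (fun u => [set f u; c]) _).
  apply: subset_leq_card; apply/subsetP => _ /imsetP[e /step_setP[u uP ee] ->].
  by rewrite ee; apply: imset_f.
move=> c ccs; set Q' := _ :|: Q; set E' := _ :|: E.
have cW' := csW _ ccs.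
pose f' x := if x == v then c else f x.
have f'v : f' v = c by rewrite /f' eqxx.
have f'W u : u \in W -> f' u = f u.
  by move=> uW; rewrite /f'; case: eqP => // uv; rewrite uv (negbTE vW) in uW.
have imW : f' @: (v |: W) = c |: f @: W.
  rewrite imsetU1 f'v; congr (_ |: _); apply: eq_in_imset => u uW; exact: f'W.
have adjQ' x y : adj Q' x y -> adj Q x y \/
    exists u c', [/\ u \in P v, c' \in cs & (x = f u /\ y = c') \/ (x = c' /\ y = f u)].
  rewrite adjU => /orP[/adjP[e]|]; last by left.
  rewrite (big_nth c) big_mkord => /bigcupP[i _ /step_setP[u uP ee]] e2.
  right; exists u, (nth c cs i); split=> //; first by rewrite mem_nth.
  by apply: set2_cases; rewrite -ee.
apply: (IH _ _ (v |: W) f').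
- move: cW; rewrite (cardsD1 v) inE vW vU/= add1n => -[<-]; apply: eq_card => x.
  by rewrite !inE negb_or andbA.
- by rewrite subUset sub1set vU.
- move=> x u xU; rewrite !inE => /orP[/eqP->|uW] xu; rewrite ?(vdown _ xU xu) ?(down _ _ xU uW xu) orbT//.
- move=> x y; rewrite !inE => /orP[/eqP->|xW] /orP[/eqP->|yW]//.
  + rewrite f'v f'W// => h; by rewrite h fW in cW'.
  + rewrite f'v f'W// => h; by rewrite -h fW in cW'.
  + by rewrite !f'W//; apply: finj.
- move=> u v'; rewrite !inE adjU => /orP[/eqP->|v'W] uP.
    have uW := PW _ uP.
    have [|e ee] := @adj_exists _ (f u) c; first by apply: contraNneq cW' => <-; apply: fW.
    by rewrite f'v f'W// (adj_val (step_set f v c) ee); apply/orP; left; apply/step_setP; exists u.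
  rewrite !f'W ?HE ?orbT//; apply: (down _ _ _ v'W) (P_rank uP).
  by case: (PU uP).
- move=> x y /adjQ'; rewrite imW !inE; case=> [/HQ1[]->|[u [c' [uP c'cs]]]]; rewrite ?orbT; auto.
  by case=> [[-> _]|[_ ->]]; rewrite fW ?orbT ?PW//; auto.
(* For [u = v] the count is zero: every exposed pair at the chosen candidate [c] leads into the
   image. *)
move=> u; rewrite !inE imW => /orP[/eqP->|uW].
  apply: leq_trans (leq0n _); rewrite leqn0 cards_eq0; apply/eqP/setP => w; rewrite !inE f'v.
  apply/negP => /andP[]; rewrite negb_or => /andP[wc wW] /adjQ'[/HQ1[]|[u' [c' [uP c'cs]]]].
  + by rewrite (negbTE cW').
  + by rewrite (negbTE wW).
  + case=> [[h _]|[_ h]]; first by rewrite h fW ?PW in cW'.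
    by rewrite h fW ?PW in wW.
(* Only the parents of [v] gain exposed pairs, at most [s] each, and each of them gains the child
   [v]. *)
have cnt : #|[set v0 in v |: W | u \in P v0]| = (#|[set v0 in W | u \in P v0]| + (u \in P v))%N.
  case: (boolP (u \in P v)) => uP.
    rewrite (cardsD1 v) !inE eqxx uP/= addnC; congr (_ + _)%N; apply: eq_card => x.
    by rewrite !inE; case: eqP => //= ->; rewrite (negbTE vW).
  rewrite addn0; apply: eq_card => x; rewrite !inE; case: eqP => //= ->.
  by rewrite (negbTE uP) andbF.
rewrite cnt mulnDr f'W//.
apply: leq_trans (leq_add (HQ2 _ uW) (leqnn _)).
apply: leq_trans (_ : #|[set w | (w \notin f @: W) && adj Q (f u) w] :|:
    (if u \in P v then [set w in cs] else set0)| <= _)%N.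
  apply: subset_leq_card; apply/subsetP => w; rewrite !inE negb_or => /andP[/andP[wc wW]].
  case/adjQ' => [h|[u' [c' [uP c'cs]]]]; first by rewrite wW h.
  case=> [[h ->]|[h _]]; last by have := csW _ c'cs; rewrite -h fW.
  have -> : u = u' by apply: finj => //; apply: PW.
  by rewrite uP inE c'cs orbT.
apply: leq_trans (leq_card_setU _ _) _; rewrite leq_add2l.
case: ifP => _; last by rewrite cards0.
by rewrite muln1 -size_cs cardsE; apply/eq_leq/card_uniqP.
Qed.

Lemma greedy_embedding : 1 - mu p (hosts n F) <= #|U|%:R * (1 - p ^+ d) ^+ s.
Proof.
(* Nothing is embedded at the start, so the initial map is arbitrary. *)
rewrite -fail00; apply: (@greedy_step _ _ _ set0 (fun v => widen_ord Vn (enum_rank v))).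
- by rewrite setD0.
- exact: sub0set.
- by move=> x u _; rewrite inE.
- by move=> x y; rewrite inE.
- by move=> u v; rewrite inE.
- by move=> x y /adjP[e]; rewrite inE.
- by move=> u; rewrite inE.
Qed.

End GreedyEmbedding.

(** * Star forests *)

Section StarPotential.
Variables (R : realType) (T : eqType) (a : T -> nat).
Implicit Types (w : T -> R) (l : seq T) (D : nat).

(* The i-th star of the list l (i >= 1), with a leaves, has weight 2 ^ i (1 - P / 2) ^ r,
   where P is the probability that a fresh row has degree at least a and r is the
   number of fresh rows left.  Embedding the largest star that fits in the next
   row makes this a supermartingale, which is at least 1 if a star remains when
   the rows are exhausted. *)
Fixpoint potential w l : R :=
  if l is z :: l' then 2 * w z + 2 * potential w l' else 0.

(** On a list sorted by decreasing [a], this removes the largest star that fits in a row of degree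
    [D]. *)
Fixpoint drop_fit D l : seq T :=
  if l is z :: l' then if (a z <= D)%N then l' else z :: drop_fit D l' else [::].

Lemma drop_fit_id D l : ~~ has (fun z => (a z <= D)%N) l -> drop_fit D l = l.
Proof. by elim: l => //= z l IH; rewrite negb_or => /andP[/negbTE-> /IH->]. Qed.

Lemma drop_fit_rem D l : has (fun z => (a z <= D)%N) l ->
  exists z, [/\ z \in l, (a z <= D)%N & drop_fit D l = rem z l].
Proof.
elim: l => //= z l IH; case: ifP => [az _|az /= /IH[z0 [z0l az0 ->]]].
  by exists z; rewrite mem_head eqxx.
exists z0; rewrite inE z0l orbT; split=> //; case: eqP => // zz0.
by rewrite zz0 az0 in az.
Qed.

Lemma potential_ge0 w l : (forall z, 0 <= w z) -> 0 <= potential w l.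
Proof. by move=> w0; elim: l => //= z l IH; rewrite addr_ge0 ?mulr_ge0. Qed.

Lemma potential_half w l D : all (fun z => (a z <= D)%N) l ->
  potential (fun z => (1 - 2^-1 * (a z <= D)%N%:R) * w z) l = 2^-1 * potential w l.
Proof.
elim: l => [|z l IH] /=; first by rewrite mulr0.
by case/andP => -> /IH ->; rewrite mulr1; move: (w z) (potential w l) => x y; lra.
Qed.

(** All stars after the first fitting one also fit. Removing that star shifts them by one index,
    which halves their weights, exactly as the factors on the right do. *)
Lemma potential_drop w l D : (forall z, 0 <= w z) -> sorted (fun x y => (a y <= a x)%N) l ->
  potential w (drop_fit D l) <= potential (fun z => (1 - 2^-1 * (a z <= D)%N%:R) * w z) l.
Proof.
move=> w0; elim: l => [|z l IH] //= zl.
have sl := path_sorted zl; case: ifP => [az|az] /=; last first.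
  by have := IH sl; rewrite mulr0 subr0 mul1r; lra.
rewrite potential_half; last first.
  have tr : transitive (fun x y => (a y <= a x)%N) by move=> y x t h1 h2; apply: leq_trans h2 h1.
  by apply: sub_all (order_path_min tr zl) => y yz; apply: leq_trans yz az.
by have := w0 z; rewrite mulr1; move: (w z) (potential w l) => x y; lra.
Qed.

End StarPotential.

(** * Embedding a star forest row by row *)

Section StarEmbedding.
Variables (R : realType) (p : R) (V : finType) (n M b : nat).
Variables (L : V -> {set V}) (F : graph V).
Hypotheses (p0 : 0 <= p) (p1 : p <= 1) (Vn : (#|V| <= n)%N).
Hypotheses (FL : forall x y, adj F x y -> y \in L x \/ x \in L y)
  (L_disj : forall z z' v, v \in L z -> v \in L z' -> z = z')
  (L_leaf : forall z v, v \in L z -> L v = set0)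
  (room : (#|[set v | [exists z, v \in L z]]| + b + M <= n)%N).

Let a z := #|L z|.
Let w r z : R := (1 - 2^-1 * tail p b (a z)) ^+ r.

Let w_ge0 r z : 0 <= w r z.
Proof. by rewrite exprn_ge0// subr_ge0; have := tail_le1 p0 p1 b (a z); lra. Qed.

(** By linearity: on average over the degree [D] of a fresh row, the factor of a star is
    [1 - tail / 2]. *)
Lemma potential_step r l :
  binom_mean p b (fun D => potential (fun z => (1 - 2^-1 * (a z <= D)%N%:R) * w r z) l) =
  potential (w r.+1) l.
Proof.
elim: l => [|z l IH] /=; first exact: binom_mean_cst.
rewrite binom_meanD !binom_meanZ IH; congr (_ + _); congr (_ * _).
rewrite (binom_mean_eq _ _ (g' := fun i => w r z * 1 + (- 2^-1 * w r z) * (a z <= i)%N%:R)); last first.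
  by move=> i; move: (w r z) ((a z <= i)%N%:R : R) => x y; lra.
rewrite binom_meanD !binom_meanZ binom_mean_cst -/(tail p b (a z)) /w exprS.
by set t := tail p b (a z); move: ((1 - 2^-1 * t) ^+ r) => y; ring.
Qed.

(** [l] lists the stars still to be embedded, so these are the centres and leaves already placed. *)
Let centers (l : seq V) := [set z | (L z != set0) && (z \notin l)].
Let leaves (l : seq V) := [set v | [exists z in centers l, v \in L z]].

Let leavesP l v : reflect (exists2 z, z \notin l & v \in L z) (v \in leaves l).
Proof.
rewrite inE; apply: (iffP existsP) => [[z /andP[]]|[z zl vz]].
  by rewrite inE => /andP[_ zl] vz; exists z.
by exists z; rewrite inE zl vz !andbT; apply/set0Pn; exists v.
Qed.

Let centers_leaf l z z' : z \in centers l -> z \notin L z'.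
Proof. by rewrite inE => /andP[Lz _]; apply: contraNN Lz => /L_leaf ->. Qed.

Let leaves_nil l v : v \in leaves l -> L v = set0.
Proof. by case/leavesP => z _; exact: L_leaf. Qed.

(** Centres lie below [M] and leaves at or above [M], so the two injective parts of [f] cannot
    collide. *)
Let star_done Q E (f : V -> 'I_n) :
  {in centers [::] &, injective f} ->
  (forall z, z \in centers [::] -> (f z < M)%N) ->
  {in leaves [::] &, injective f} ->
  (forall v, v \in leaves [::] -> (M <= f v)%N) ->
  (forall z v, v \in L z -> adj E (f z) (f v)) ->
  fail_prob p (hosts n F) Q E = 0.
Proof.
move=> cinj cM linj lM HE; rewrite (fail_in p (@hosts_incr _ _ F))//.
apply: (hosts_partial Vn (f := f) (U := centers [::] :|: leaves [::])).
- move=> u v /FL[vu|uv]; rewrite in_setU; apply/orP; [left|right].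
    by rewrite inE andbT; apply/set0Pn; exists v.
  by apply/leavesP; exists v.
- have sep u v : u \in centers [::] -> v \in leaves [::] -> f u != f v.
    move=> /cM uM /lM vM; apply/eqP => /(congr1 val)/= uv.
    by move: uM; rewrite uv ltnNge vM.
  move=> u v; rewrite !in_setU => /orP[uc|ul] /orP[vc|vl].
  + exact: cinj.
  + by move=> uv; have := sep _ _ uc vl; rewrite uv eqxx.
  + by move=> uv; have := sep _ _ vc ul; rewrite uv eqxx.
  + exact: linj.
- by move=> u v /FL[/HE//|/HE]; rewrite adj_sym.
Qed.

(** Induction on the fresh rows [xs], candidate centres below [M] none of whose pairs with the
    vertices from [M] on has been exposed. *)
Let star_step (xs : seq 'I_n) l Q E (f : V -> 'I_n) :
  uniq xs -> (forall x, x \in xs -> (x < M)%N) ->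
  uniq l -> sorted (fun x y => (a y <= a x)%N) l -> (forall z, z \in l -> L z != set0) ->
  {in centers l &, injective f} ->
  (forall z, z \in centers l -> (f z < M)%N /\ f z \notin xs) ->
  {in leaves l &, injective f} ->
  (forall v, v \in leaves l -> (M <= f v)%N) ->
  (forall z v, z \notin l -> v \in L z -> adj E (f z) (f v)) ->
  (forall x y : 'I_n, x \in xs -> (M <= y)%N -> ~~ adj Q x y) ->
  fail_prob p (hosts n F) Q E <= potential (w (size xs)) l.
Proof.
elim: xs l Q E f => [|x xs IH] l Q E f uxs xsM ul sl l0 cinj cM linj lM HE HQ.
  case: l ul sl l0 cinj cM linj lM HE => [|z l] ul sl l0 cinj cM linj lM HE.
    rewrite (@star_done _ _ f)//; first by move=> z /cM[].
    by move=> z v; apply: HE.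
  (* A star remains but no row does: its weight is [1], so the potential is at least [2]. *)
  apply: le_trans (fail_le1 p0 p1 _ _ _) _; rewrite /= /w expr0 mulr1.
  have := @potential_ge0 R V (w 0) l (w_ge0 0); rewrite /w /=; lra.
have xM : (x < M)%N by apply: xsM; rewrite mem_head.
pose Y := f @: leaves l.
have cY : (#|Y| <= #|[set v | [exists z, v \in L z]]|)%N.
  apply: leq_trans (leq_imset_card _ _) _; apply: subset_leq_card; apply/subsetP => v.
  by case/leavesP => z _ vz; rewrite inE; apply/existsP; exists z.
pose B := [set y : 'I_n | (M <= y)%N].
have cB : (n <= #|B| + M)%N.
  rewrite -[X in (X <= _)%N]card_ord -(cardsC B) leq_add2l.
  have -> : M = #|[set: 'I_M]| by rewrite cardsT card_ord.
  have [Mn|nM] := leqP M n; last first.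
    by rewrite (leq_trans (max_card _))// cardsT !card_ord ltnW.
  have winj : injective (widen_ord Mn) by move=> i j /(congr1 val)/= /val_inj.
  rewrite -[X in (_ <= X)%N](card_imset _ winj); apply: subset_leq_card.
  apply/subsetP => y; rewrite !inE -ltnNge => yM; apply/imsetP.
  by exists (Ordinal yM); rewrite ?inE//; apply: val_inj.
have cBY : (b <= #|B :\: Y|)%N.
  by rewrite cardsD; have := subset_leq_card (subsetIr B Y); lia.
pose us := take b (enum (B :\: Y)).
have size_us : size us = b by rewrite size_takel// -cardE.
have uus : uniq us by rewrite take_uniq// enum_uniq.
have usP y : y \in us -> (M <= y)%N /\ y \notin Y.
  by move=> /mem_take; rewrite mem_enum !inE => /andP[].
pose S := [set e : vpair 'I_n | [exists y in [set y in us], val e == [set x; y]]].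
have SP e : reflect (exists2 y, y \in us & val e = [set x; y]) (e \in S).
  rewrite inE; apply: (iffP existsP) => [[y]|[y yus h]].
    by rewrite inE => /andP[yus /eqP h]; exists y.
  by exists y; rewrite inE yus h eqxx.
have xy (y : 'I_n) : (M <= y)%N -> x != y.
  by move=> My; apply: contraTneq xM => ->; rewrite -leqNgt.
have set2x (y y' : 'I_n) : (M <= y)%N -> [set x; y] = [set x; y'] -> y = y'.
  by move=> My /set2_cases[[]|[h1 h2]] //; rewrite h2 in My; rewrite ltnNge My in xM.
have cS : #|S| = b.
  rewrite -(card_imset _ val_inj) -size_us -(card_uniqP uus).
  rewrite -[RHS](@card_in_imset _ _ (fun y : 'I_n => [set x; y]) (mem us)); last first.
    by move=> y y' /usP[My _] _ /=; apply: set2x.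
  apply: eq_card => A; apply/imsetP/imsetP => [[e /SP[y yus ee] ->]|[y yus ->]].
    by exists y.
  have [e ee] := adj_exists (xy _ (usP _ yus).1).
  by exists e => //; apply/SP; exists y.
have dSQ : [disjoint S & Q].
  rewrite disjoint_subset; apply/subsetP => e /SP[y yus ee]; rewrite inE.
  by rewrite -(adj_val Q ee); apply: HQ; [rewrite mem_head | case: (usP _ yus)].
rewrite -potential_step; apply: le_trans (fail_reveal p0 p1 (g := fun D =>
  potential (fun z => (1 - 2^-1 * (a z <= D)%N%:R) * w (size xs) z) l) dSQ _) _; last first.
  by rewrite cS.
move=> N NS; apply: le_trans _ (potential_drop #|N| (w_ge0 _) sl).
have HQ' (x' y : 'I_n) : x' \in xs -> (M <= y)%N -> ~~ adj (S :|: Q) x' y.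
  move=> x'xs My; have x'x : x' != x.
    by apply: contraTneq x'xs => ->; case/andP: uxs.
  have x'M : (x' < M)%N by apply: xsM; rewrite inE x'xs orbT.
  rewrite adjU negb_or HQ ?inE ?x'xs ?orbT// andbT.
  apply/negP => /adjP[e /SP[y' y'us ee]]; rewrite ee => /set2_cases[[h _]|[_ h]].
    by rewrite h eqxx in x'x.
  by have := (usP _ y'us).1; rewrite h leqNgt x'M.
have uxs' : uniq xs by case/andP: uxs.
have xsM' x' : x' \in xs -> (x' < M)%N by move=> h; apply: xsM; rewrite inE h orbT.
(* If no remaining star fits, the row is skipped. *)
case: (boolP (has (fun z => (a z <= #|N|)%N) l)) => [|hN]; last first.
  rewrite (drop_fit_id hN); apply: (IH _ _ _ f) => //.
    by move=> z /cM[zM]; rewrite inE negb_or => /andP[].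
  by move=> z v zl vz; rewrite adjU HE ?orbT.
case/drop_fit_rem => z0 [z0l az0 ->].
pose nb := [set y in us | adj N x y].
have cnb : (a z0 <= #|nb|)%N.
  apply: leq_trans az0 _; rewrite -(card_imset _ val_inj).
  apply: leq_trans (leq_imset_card (fun y : 'I_n => [set x; y]) _); apply: subset_leq_card.
  apply/subsetP => _ /imsetP[e eN ->]; have /SP[y yus ee] := subsetP NS _ eN.
  by apply/imsetP; exists y => //; rewrite inE yus (adj_val N ee).
(* The centre [z0] goes to [x] and its leaves to the first neighbours found, in enumeration
   order. *)
pose f' v := if v == z0 then x else
  if v \in L z0 then nth x (enum nb) (index v (enum (L z0))) else f v.
have idx v : v \in L z0 -> (index v (enum (L z0)) < size (enum nb))%N.
  move=> vL; rewrite -cardE; apply: leq_trans cnb; rewrite /a cardE index_mem.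
  by rewrite mem_enum.
have z0L z : z0 \notin L z.
  by apply: contraNN (l0 _ z0l) => /L_leaf ->.
have f'z0 : f' z0 = x by rewrite /f' eqxx.
have f'L v : v \in L z0 -> f' v \in nb /\ f' v = nth x (enum nb) (index v (enum (L z0))).
  move=> vL; have -> : f' v = nth x (enum nb) (index v (enum (L z0))).
    by rewrite /f' vL; case: eqP => // vz0; have := z0L z0; rewrite -{1}vz0 vL.
  by split=> //; rewrite -(mem_enum nb); apply: mem_nth; apply: idx.
have f'E v : v != z0 -> v \notin L z0 -> f' v = f v.
  by move=> /negbTE vz /negbTE vL; rewrite /f' vz vL.
have memrem z : (z \in rem z0 l) = (z != z0) && (z \in l) by rewrite mem_rem_uniq// inE.
have nmemrem z : (z \notin rem z0 l) = (z == z0) || (z \notin l).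
  by rewrite memrem negb_and negbK.
have cE z : z \in centers l -> f' z = f z.
  move=> zc; apply: f'E; last exact: centers_leaf zc.
  by apply: contraTneq zc => ->; rewrite inE z0l andbF.
have lE v : v \in leaves l -> f' v = f v.
  move=> vl; apply: f'E.
    by apply: contraTneq (l0 _ z0l) => <-; rewrite (leaves_nil vl) eqxx.
  case/leavesP: vl => z zl vz; apply/negP => /(L_disj vz) zz0.
  by rewrite zz0 z0l in zl.
have centers' z : z \in centers (rem z0 l) -> z = z0 \/ z \in centers l.
  rewrite !inE nmemrem => /andP[Lz /orP[/eqP|]]; first by left.
  by move=> zl; right; rewrite Lz.
have leaves' v : v \in leaves (rem z0 l) -> v \in L z0 \/ v \in leaves l.
  case/leavesP => z; rewrite nmemrem => /orP[/eqP->|zl vz]; first by left.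
  by right; apply/leavesP; exists z.
have nbP y : y \in nb -> [/\ (M <= y)%N, y \notin Y & adj N x y].
  by rewrite inE => /andP[/usP[]].
apply: (IH _ _ _ f') => //.
- exact: rem_uniq.
- by apply: (subseq_sorted _ (rem_subseq _ _) sl) => y x' t h1 h2; apply: leq_trans h2 h1.
- by move=> z; rewrite memrem => /andP[_]; apply: l0.
- move=> z z' /centers'[->|zc] /centers'[->|z'c] //; rewrite ?f'z0 ?cE//.
  + by move=> h; have [_] := cM _ z'c; rewrite -h mem_head.
  + by move=> h; have [_] := cM _ zc; rewrite h mem_head.
  + exact: cinj.
- move=> z /centers'[->|zc]; first by rewrite f'z0; split=> //; case/andP: uxs.
  by rewrite cE//; have [zM] := cM _ zc; rewrite inE negb_or => /andP[].
- move=> v v' /leaves'[vL|vl] /leaves'[v'L|v'l].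
  + rewrite (f'L _ vL).2 (f'L _ v'L).2 => /eqP; rewrite nth_uniq ?enum_uniq ?idx// => /eqP h.
    rewrite -(nth_index v (s := enum (L z0)) (x := v)) ?mem_enum// h nth_index ?mem_enum//.
  + rewrite (lE _ v'l) => h; have [_ + _] := nbP _ (f'L _ vL).1.
    by rewrite h imset_f.
  + rewrite (lE _ vl) => h; have [_ + _] := nbP _ (f'L _ v'L).1.
    by rewrite -h imset_f.
  + by rewrite !lE//; apply: linj.
- move=> v /leaves'[vL|vl]; first by have [] := nbP _ (f'L _ vL).1.
  by rewrite lE//; apply: lM.
- move=> z v; rewrite nmemrem adjU => /orP[/eqP->|zl] vz.
    by rewrite f'z0; have [_ _ ->] := nbP _ (f'L _ vz).1.
  rewrite cE; last by rewrite inE zl andbT; apply/set0Pn; exists v.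
  rewrite lE; last by apply/leavesP; exists z.
  by rewrite HE ?orbT.
Qed.

Lemma star_embedding (zs : seq V) : uniq zs -> (forall z, (z \in zs) = (L z != set0)) ->
  sorted (fun x y => (#|L y| <= #|L x|)%N) zs ->
  1 - mu p (hosts n F) <=
    potential (fun z => (1 - 2^-1 * tail p b #|L z|) ^+ M) zs.
Proof.
move=> uzs zsE szs; have Mn : (M <= n)%N by lia.
have c0 : centers zs = set0 by apply/setP => z; rewrite !inE zsE andbN.
have l0 : leaves zs = set0.
  apply/setP => v; rewrite in_set0; apply/negP => /leavesP[z]; rewrite zsE negbK => /eqP->.
  by rewrite inE.
rewrite -fail00.
have -> : M = size [seq widen_ord Mn i | i <- enum 'I_M] by rewrite size_map size_enum_ord.
apply: (@star_step _ _ _ _ (fun v => widen_ord Vn (enum_rank v))) => //.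
- by rewrite map_inj_uniq ?enum_uniq// => i j /(congr1 val)/= /val_inj.
- by move=> x /mapP[i _ ->] /=.
- by move=> z; rewrite zsE.
- by move=> z; rewrite c0 inE.
- by move=> z; rewrite c0 inE.
- by move=> z; rewrite l0 inE.
- by move=> z; rewrite l0 inE.
- by move=> z v; rewrite zsE negbK => /eqP->; rewrite inE.
- by move=> x y _ _; apply/adjP => -[e]; rewrite inE.
Qed.

End StarEmbedding.

(** * Elementary estimates for factorials and binomial coefficients *)

Section RealBounds.
Variable R : realType.
Implicit Types (x : R) (n k : nat).

Lemma expR1_le4 : expR 1 <= 4 :> R.
Proof.
have h : 2^-1 <= expR (- 2^-1) :> R by apply: le_trans (expR_ge1Dx _); lra.
have -> : expR 1 = expR (2^-1) * expR (2^-1) :> R by rewrite -expRD; congr expR; lra.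
have e0 := expR_gt0 (2^-1 : R).
have : expR (2^-1) * expR (- 2^-1) = 1 :> R by rewrite -expRD subrr expR0.
move: (expR (2^-1)) (expR _) h e0 => x y h e0 xy.
have x2 : x <= 2 by have := ler_wpM2l (ltW e0) h; lra.
by have : x * x <= 2 * 2 by [rewrite ler_pM// ltW]; lra.
Qed.

(** A weak Stirling bound, by induction from [(1 + 1 / k) ^ k <= e <= 4]. *)
Lemma le_expn_fact k : k%:R ^+ k <= 4 ^+ k * k`!%:R :> R.
Proof.
elim: k => [|k IH]; first by rewrite !expr0 mul1r.
have step : k.+1%:R ^+ k <= 4 * k%:R ^+ k :> R.
  case: k {IH} => [|k]; first by rewrite !expr0; lra.
  have k0 : 0 < k.+1%:R :> R by rewrite ltr0n.
  have -> : k.+2%:R = (1 + k.+1%:R^-1) * k.+1%:R :> R.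
    by rewrite mulrDl mul1r mulVf ?gt_eqF// natr1.
  rewrite exprMn ler_wpM2r ?exprn_ge0//; apply: le_trans expR1_le4.
  apply: le_trans (_ : expR (k.+1%:R^-1) ^+ k.+1 <= _).
    by apply: lerXn2r; rewrite ?nnegrE ?expR_ge0 ?addr_ge0 ?expR_ge1Dx ?invr_ge0.
  by rewrite -expRM_natl mulfV// gt_eqF.
rewrite [leLHS]exprS factS natrM exprS.
have := ler_wpM2l (ler0n R k.+1) step; have := ler_wpM2l (ler0n R k.+1) IH.
move: (k.+1%:R) (k%:R ^+ k) (k.+1%:R ^+ k) (4 ^+ k) (k`!%:R : R) => *; lra.
Qed.

Lemma bin_le n k : (0 < k)%N -> 'C(n, k)%:R <= (4 * n%:R / k%:R) ^+ k :> R.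
Proof.
move=> k0; have k0' : 0 < k%:R :> R by rewrite ltr0n.
rewrite exprMn exprVn exprMn ler_pdivlMr ?exprn_gt0//.
apply: le_trans (ler_wpM2l (ler0n _ _) (le_expn_fact k)) _.
rewrite mulrCA ler_wpM2l ?exprn_ge0// -natrM bin_ffact -natrX ler_nat.
by elim: k {k0 k0'} => [|k IH] //; rewrite ffactnSr expnSr leq_mul// leq_subr.
Qed.

End RealBounds.

(** * First moment for star forests *)

Section StarCopies.
Variables (R : realType) (V : finType) (n : nat) (H : graph V) (L : V -> {set V}).
Variables (Z : {set V}) (a : nat).
Hypotheses (Vn : (#|V| <= n)%N)
  (L_leaf : forall z v, v \in L z -> L v = set0)
  (LH : forall z v, v \in L z -> adj H z v)
  (a0 : (0 < a)%N) (Z0 : (0 < #|Z|)%N) (La : forall z, z \in Z -> (a <= #|L z|)%N).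

Let q := expectation_threshold R (containing n H).

(** Stars pruned to exactly [a] leaves. *)
Let L' z := [set v in take a (enum (L z))].

Let L'L z v : v \in L' z -> v \in L z.
Proof. by rewrite inE => /mem_take; rewrite mem_enum. Qed.

Let cL' z : z \in Z -> #|L' z| = a.
Proof.
move=> zZ; rewrite cardsE (card_uniqP _) ?take_uniq ?enum_uniq//.
by rewrite size_takel// -cardE La.
Qed.

(** The vertex type is arbitrary, to serve both for the subgraph of [H] and for its copies in
    [n]. *)
Definition star_forest (W : finType) (X : {set W}) (g : W -> {set W}) : graph W :=
  [set e | [exists x in X, exists y in g x, val e == [set x; y]]].

Lemma star_forestP (W : finType) (X : {set W}) (g : W -> {set W}) e :
  reflect (exists x y, [/\ x \in X, y \in g x & val e = [set x; y]]) (e \in star_forest X g).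
Proof.
rewrite inE; apply: (iffP existsP) => [[x /andP[xX /existsP[y /andP[yg /eqP ee]]]]|].
  by exists x, y.
case=> x [y [xX yg ee]]; exists x; rewrite xX/=; apply/existsP; exists y.
by rewrite yg ee eqxx.
Qed.

Let F := star_forest Z L'.

Let FH : F \subset H.
Proof.
apply/subsetP => e /star_forestP[z [v [zZ /L'L vz ee]]].
by rewrite -(adj_val H ee) LH.
Qed.

(** Pairs of a centre and a leaf give distinct edges, since a leaf has no leaves of its own. *)
Let cF : (#|Z| * a <= #|F|)%N.
Proof.
pose T := [set u : V * V | (u.1 \in Z) && (u.2 \in L' u.1)].
have <- : #|T| = (#|Z| * a)%N.
  rewrite -sum1_card -sum_nat_const.
  rewrite (eq_bigr (fun z => \sum_(v in L' z) 1)%N); last first.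
    by move=> z zZ; rewrite sum1_card cL'.
  by rewrite pair_big_dep; apply: eq_bigl => u; rewrite inE.
rewrite -(card_in_imset (f := fun u : V * V => [set u.1; u.2])); last first.
  move=> [z v] [z' v']; rewrite !inE/= => /andP[zZ vz] /andP[z'Z v'z'].
  case/set2_cases => -[zz' vv']; first by rewrite zz' vv'.
  have : L z != set0 by apply/set0Pn; exists v; apply: L'L; rewrite inE.
  by rewrite zz' (@L_leaf z') ?eqxx//; apply: L'L; rewrite inE.
rewrite -[X in (_ <= X)%N](card_imset _ val_inj); apply: subset_leq_card.
apply/subsetP => A /imsetP[[z v]]; rewrite inE => /andP[/= zZ vz] ->.
have [|e ee] := @adj_exists _ z v; first by apply: adj_neq (LH (L'L vz)).
by apply/imsetP; exists e => //; apply/star_forestP; exists z, v.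
Qed.

(** A copy is determined by its set of centres and a set of [a] leaves for each centre. *)
Let card_copies : (#|copies n F| <= 'C(n, #|Z|) * 'C(n, a) ^ #|Z|)%N.
Proof.
pose sub k := [set X : {set 'I_n} | #|X| == k].
pose G (X : {set 'I_n}) := [set star_forest X (g : {ffun 'I_n -> {set 'I_n}}) |
  g in pffun_on set0 X (mem (sub a))].
have csub k : #|sub k| = 'C(n, k) by rewrite card_draws card_ord.
apply: leq_trans (_ : #|\bigcup_(X in sub #|Z|) G X| <= _)%N; last first.
  rewrite -csub; apply: leq_card_bigcup => X; rewrite inE => /eqP cX.
  apply: leq_trans (leq_imset_card _ _) _.
  by rewrite card_pffun_on cX csub.
apply: subset_leq_card; apply/subsetP => _ /imsetP[f /injectiveP finj ->].
apply/bigcupP; exists (f @: Z); first by rewrite inE card_imset.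
pose g := [ffun x => if [pick z in Z | f z == x] is Some z then f @: L' z else set0].
have gE z : z \in Z -> g (f z) = f @: L' z.
  move=> zZ; rewrite ffunE; case: pickP => [z' /andP[_ /eqP /finj->] //|/(_ z)].
  by rewrite zZ eqxx.
apply/imsetP; exists g.
  apply/pffun_onP; split.
    apply/subsetP => x; rewrite unfold_in ffunE.
    by case: pickP => [z /andP[zZ /eqP <-] _|]; rewrite ?eqxx//; apply: imset_f.
  move=> y /imageP[x /imsetP[z zZ ->] ->]; rewrite gE// inE card_imset// cL'//.
apply/setP => e; rewrite inE; apply/existsP/star_forestP.
  case=> e0 /andP[/star_forestP[z [v [zZ vz e0e]]] /eqP ->].
  exists (f z), (f v); rewrite gE//; split; rewrite ?imset_f//.
  by rewrite e0e imsetU1 imset_set1.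
case=> _ [y [/imsetP[z zZ ->]]]; rewrite gE// => /imsetP[v vz ->] ee.
have [|e0 e0e] := @adj_exists _ z v; first by apply: adj_neq (LH (L'L vz)).
exists e0; rewrite ee e0e imsetU1 imset_set1 eqxx andbT.
by apply/star_forestP; exists z, v.
Qed.

(* The expected number of copies of the star forest F in G(n, r) is at most
   ((4 n / #|Z|) (4 n r / a) ^+ a) ^+ #|Z|. *)
Lemma star_expectation_threshold :
  0 <= q /\ a%:R ^+ a * #|Z|%:R <= (32 * q) ^+ a * n%:R ^+ a.+1.
Proof.
have Zn : (#|Z| <= n)%N by apply: leq_trans (max_card _) Vn.
have an : (a <= n)%N.
  have [z zZ] := card_gt0P Z0; apply: leq_trans (La zZ) _.
  by apply: leq_trans (max_card _) Vn.
have n0 : 0 < n%:R :> R by rewrite ltr0n (leq_trans Z0).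
have a0' : 0 < a%:R :> R by rewrite ltr0n.
have Z0' : 0 < #|Z|%:R :> R by rewrite ltr0n.
(* Chosen so that [y ^+ a] cancels the factor [n / #|Z|] of the first moment; what remains at [r] is
   [(4 * 8^-1 ^+ a) ^+ #|Z|], at most [2^-1]. *)
pose y : R := (#|Z|%:R / n%:R) `^ a%:R^-1.
have y0 : 0 <= y by exact: powR_ge0.
have ya : y ^+ a = #|Z|%:R / n%:R.
  rewrite -powR_mulrn// -powRrM mulVf ?gt_eqF// powRr1// divr_ge0// ltW.
pose r := a%:R / (32 * n%:R) * y.
have r0 : 0 <= r by rewrite mulr_ge0// divr_ge0// ?mulr_ge0// ltW.
have an' : a%:R / (32 * n%:R) <= 1 :> R.
  by rewrite ler_pdivrMr ?mulr_gt0// mul1r; have : a%:R <= n%:R :> R by [rewrite ler_nat]; lra.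
have y1 : y <= 1.
  rewrite leNgt; apply/negP => y1; have : 1 < y ^+ a by rewrite exprn_egt1// -lt0n.
  by rewrite ya ltr_pdivlMr// mul1r ltr_nat ltnNge Zn.
have r1 : r <= 1 by rewrite mulr_ile1// divr_ge0// ?mulr_ge0// ltW.
have rq : r <= q.
  apply: (@expectation_threshold_copies _ _ _ _ F) => //; first by rewrite r0 r1.
  apply: le_trans (_ : ('C(n, #|Z|) * 'C(n, a) ^ #|Z|)%N%:R * r ^+ (#|Z| * a) <= _).
    by apply: ler_pM; rewrite ?exprn_ge0 ?ler_nat// ler_wiXn2l.
  rewrite natrM natrX mulnC exprM -mulrA -exprMn.
  apply: le_trans (_ : (4 * n%:R / #|Z|%:R) ^+ #|Z| *
      ((4 * n%:R / a%:R) ^+ a * r ^+ a) ^+ #|Z| <= _).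
    apply: ler_pM; rewrite ?exprn_ge0 ?mulr_ge0 ?exprn_ge0 ?bin_le//.
    apply: lerXn2r; rewrite ?nnegrE ?mulr_ge0 ?exprn_ge0 ?divr_ge0 ?mulr_ge0 ?(ltW n0) ?(ltW a0')//.
    by rewrite ler_wpM2r ?exprn_ge0 ?bin_le.
  rewrite -!exprMn; set t := _ * _.
  have -> : t = 4 * 8^-1 ^+ a.
    rewrite /t /r [in X in _ * X]mulrA exprMn ya.
    have -> : 4 * n%:R / a%:R * (a%:R / (32 * n%:R)) = 8^-1 :> R.
      by field; rewrite ?gt_eqF.
    by field; rewrite ?gt_eqF.
  have t0 : 0 <= 4 * 8^-1 ^+ a :> R by rewrite mulr_ge0// exprn_ge0// invr_ge0.
  have t1 : 4 * 8^-1 ^+ a <= 2^-1 :> R.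
    case: (a) a0 => // a' _; rewrite exprS.
    have : 8^-1 ^+ a' <= 1 :> R by rewrite exprn_ile1 ?invr_ge0//; lra.
    by move: (_ ^+ a') => u; lra.
  case: #|Z| Z0 => // m _; rewrite exprS.
  have : (4 * 8^-1 ^+ a) ^+ m <= 1 :> R by rewrite exprn_ile1//; lra.
  by move=> h; apply: le_trans t1; rewrite ler_piMr.
have q0 : 0 <= q by apply: le_trans rq.
split=> //; have : (32 * r) ^+ a * n%:R ^+ a.+1 <= (32 * q) ^+ a * n%:R ^+ a.+1.
  rewrite ler_wpM2r ?exprn_ge0 ?(ltW n0)//; apply: lerXn2r; rewrite ?nnegrE ?mulr_ge0//.
  by rewrite ler_wpM2l.
apply: le_trans; rewrite le_eqVlt; apply/orP; left; apply/eqP.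
have -> : 32 * r = a%:R / n%:R * y by rewrite /r; field; rewrite gt_eqF.
by rewrite exprMn ya exprMn exprVn exprS; field; rewrite !gt_eqF// exprn_gt0.
Qed.

End StarCopies.

(** * Lower bounds for binomial tails *)

Section TailBounds.
Variables (R : realType) (p : R).
Hypotheses (p0 : 0 <= p) (p1 : p <= 1).

Lemma expr1B_le (x : R) k : x <= 1 -> (1 - x) ^+ k <= expR (- (k%:R * x)).
Proof.
move=> x1; rewrite -mulrN expRM_natl; apply: lerXn2r; rewrite ?nnegrE ?expR_ge0 ?subr_ge0//.
exact: expR_ge1Dx.
Qed.

Lemma expr_pairM (x y : R) m k h : x ^+ (m * h) * y ^+ (k * h) = (x ^+ m * y ^+ k) ^+ h.
Proof. by rewrite exprMn !exprM. Qed.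

(** [tail_chernoff] bounds the failure probability by [2 ^ a * expR (- 8 a)], which is at most
    [(2 / 9) ^ a]. *)
Lemma tail_half b a : (0 < a)%N -> 16 * a%:R <= b%:R * p -> 2^-1 <= tail p b a.
Proof.
move=> a0 h; have p2 : p / 2 <= 1 by have := p1; lra.
have := le_trans (tail_chernoff p0 p1 b a) (ler_wpM2l (exprn_ge0 _ (ler0n R 2)) (expr1B_le b p2)).
have e8 : expR (- (8 : R)) <= 9^-1.
  rewrite expRN lef_pV2 ?posrE ?expR_gt0//; apply: le_trans (expR_ge1Dx _); lra.
have : expR (- (b%:R * (p / 2))) <= 9^-1 ^+ a :> R.
  apply: le_trans (_ : expR (- (8 : R)) ^+ a <= _).
    by rewrite -expRM_natl ler_expR; move: (b%:R) (a%:R) h => x y h; lra.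
  by apply: lerXn2r; rewrite ?nnegrE ?expR_ge0 ?invr_ge0.
move=> /(ler_wpM2l (exprn_ge0 a (ler0n R 2))); rewrite -exprMn.
have : (2 / 9) ^+ a <= 2^-1 :> R.
  case: a a0 {h} => // a _; rewrite exprS.
  have : (2 / 9) ^+ a <= 1 :> R by rewrite exprn_ile1; lra.
  have : 0 <= (2 / 9) ^+ a :> R by rewrite exprn_ge0//; lra.
  by move: (_ ^+ a) => u; lra.
by move: (tail _ _ _) (_ ^+ a) (_ * expR _) => *; lra.
Qed.

(** Cut the trials into [a] blocks of [t = b %/ a]. As [p * t <= 16], a block has a success with
    probability at least [p * t / 17], and [b <= 2 * a * t] turns 17 into 34. *)
Lemma tail_block b a : (0 < a <= b)%N -> b%:R * p <= 16 * a%:R ->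
  (p * b%:R / (34 * a%:R)) ^+ a <= tail p b a.
Proof.
case/andP => a0 ab h; pose t := (b %/ a)%N.
have a0' : 0 < a%:R :> R by rewrite ltr0n.
have tb : (a * t <= b)%N by rewrite mulnC leq_trunc_div.
have t1 : (1 <= t)%N by rewrite divn_gt0.
have bt : b%:R <= 2 * a%:R * t%:R :> R.
  rewrite -!natrM ler_nat /t; have := ltn_ceil b a0; move: t1; rewrite /t.
  move: (b %/ a)%N => u u1; rewrite mulSn => bu.
  have : (a * 1 <= a * u)%N by rewrite leq_mul2l u1 orbT.
  by rewrite -mulnA mul2n -addnn muln1 [(u * a)%N]mulnC in bu *; lia.
have pt : p * t%:R <= 16.
  have : a%:R * t%:R <= b%:R :> R by rewrite -natrM ler_nat.
  move=> /(ler_wpM2l p0) h'; rewrite -(ler_pM2l a0').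
  by move: h h'; move: (a%:R) (t%:R) (b%:R) => x y z; lra.
apply: le_trans (_ : tail p (a * t) a <= _); last first.
  by rewrite -(subnK tb) tail_mono.
apply: le_trans (tail_mul p0 p1 t a).
have lhs0 : 0 <= p * b%:R / (34 * a%:R) by rewrite divr_ge0 ?mulr_ge0// ltW.
have pt0 : 0 <= p * t%:R by rewrite mulr_ge0.
have key : p * b%:R / (34 * a%:R) <= 1 - (1 - p) ^+ t.
  apply: le_trans (_ : p * t%:R / 17 <= _).
    rewrite ler_pdivrMr ?mulr_gt0//; move: (ler_wpM2l p0 bt).
    by move: (b%:R) (t%:R) (a%:R) => x y z; lra.
  (* From [expR (- z) <= 1 / (1 + z)] one gets [1 - expR (- z) >= z / 17] for [0 <= z <= 16]. *)
  have e1 := expr1B_le t p1; have e2 := expR_ge1Dx (t%:R * p).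
  have e3 : expR (- (t%:R * p)) * expR (t%:R * p) = 1 :> R by rewrite -expRD addNr expR0.
  have e4 := expR_gt0 (- (t%:R * p)).
  move: e1 e2 e3 e4 pt pt0; rewrite [t%:R * p]mulrC.
  move: (expR (- (p * t%:R))) (expR (p * t%:R)) ((1 - p) ^+ t) => x y u.
  move: (p * t%:R) => z ux zy xy x0 z16 z0.
  have h1 : x * (1 + z) <= x * y by rewrite ler_wpM2l// ltW.
  rewrite xy in h1.
  have h2 : 0 <= (1 - x) * (16 - z).
    have : x <= 1 by have : 0 <= x * z by [rewrite mulr_ge0// ltW]; lra.
    by move=> x1; rewrite mulr_ge0// subr_ge0.
  have h3 : x * z <= 1 - x by lra.
  lra.
by apply: lerXn2r; rewrite ?nnegrE//; apply: le_trans key.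
Qed.

End TailBounds.

(** * Summing the potential *)

Section PotentialBound.
Variables (R : realType) (T : eqType) (z0 : T).

Lemma potentialE (w : T -> R) l :
  potential w l = \sum_(j < size l) 2 ^+ j.+1 * w (nth z0 l j).
Proof.
elim: l => [|z l IH]; first by rewrite big_ord0.
rewrite /= big_ord_recl IH expr1 /=; congr (_ + _); rewrite mulr_sumr.
by apply: eq_bigr => j _; rewrite mulrA -exprS.
Qed.

Lemma geometric_sum_le (rho : R) m : 0 <= rho -> rho <= 2^-1 ->
  \sum_(j < m) rho ^+ j.+1 <= 2 * rho.
Proof.
move=> r0 r1; elim: m => [|m IH]; first by rewrite big_ord0 mulr_ge0.
rewrite big_ord_recl expr1 (eq_bigr (fun j : 'I_m => rho * rho ^+ j.+1)); last first.
  by move=> j _; rewrite -exprS.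
rewrite -mulr_sumr; have := ler_wpM2l r0 IH; have : rho * (2 * rho) <= rho by nra.
by move: (\sum_(_ < _) _) => *; lra.
Qed.

Lemma potential_le (w : T -> R) l rho tau : 0 <= rho -> rho <= 2^-1 ->
  (forall j, (j < size l)%N -> 2 ^+ j.+1 * w (nth z0 l j) <= rho ^+ j.+1 + tau) ->
  potential w l <= 2 * rho + (size l)%:R * tau.
Proof.
move=> r0 r1 H; rewrite potentialE; apply: le_trans (_ : \sum_(j < size l) (rho ^+ j.+1 + tau) <= _).
  by apply: ler_sum => j _; apply: H.
rewrite big_split/=; apply: lerD; first exact: geometric_sum_le.
by rewrite sumr_const card_ord mulr_natl.
Qed.

End PotentialBound.

(** * Star forests in the random graph *)

Section StarHosts.
Variables (R : realType) (p kappa : R) (V : finType) (n h : nat).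
Variables (L : V -> {set V}) (F : graph V) (zs : seq V).
Hypotheses (p0 : 0 <= p) (p1 : p <= 1) (Vn : (#|V| <= n)%N).
Hypotheses (FL : forall x y, adj F x y -> y \in L x \/ x \in L y)
  (L_disj : forall z z' v, v \in L z -> v \in L z' -> z = z')
  (L_leaf : forall z v, v \in L z -> L v = set0)
  (h0 : (0 < h)%N) (hn : (64 * h <= n <= 128 * h)%N)
  (cL : (#|[set v | [exists z, v \in L z]]| <= 2 * h)%N)
  (czs : (size zs <= 2 * h)%N).
Hypotheses (uzs : uniq zs) (zsE : forall z, (z \in zs) = (L z != set0))
  (szs : sorted (fun x y => (#|L y| <= #|L x|)%N) zs).
Hypotheses (kappa4 : 4 <= kappa)
  (star_p : forall z0 j, (j < size zs)%N -> let a := #|L (nth z0 zs j)| in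
     (2176 * kappa * a%:R) ^+ a * j.+1%:R <= p ^+ a * n%:R ^+ a.+1).

(** In the potential, the weighted term of each star is at most [(2 / kappa) ^+ j.+1] or at most
    [4^-1 ^+ h], according to whether a row is unlikely or likely to fit it; [potential_le] sums
    these. *)
Lemma star_hosts : 1 - mu p (hosts n F) <= 4 / kappa + 2 / h%:R.
Proof.
have k4 := kappa4; have k0 : 0 < kappa by lra.
have [z0 _|V0] := pickP (fun _ : V => true); last first.
  have := @star_embedding R p V n 0 0 L F p0 p1 Vn FL L_disj L_leaf _ zs uzs zsE szs.
  have -> : zs = [::] by case: (zs) => // z; have := V0 z.
  move=> /= H; apply: le_trans (H _) _.
    by rewrite !addn0 (leq_trans (max_card _)).
  by rewrite addr_ge0 ?divr_ge0// ltW.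
(* There are at most [2 * h] leaves, [16 * h] tests per row and [32 * h] rows, within
   [64 * h <= n]. *)
have room : (#|[set v | [exists z, v \in L z]]| + 16 * h + 32 * h <= n)%N.
  by move: cL hn; move: #|_| => c; clear; lia.
apply: le_trans (star_embedding p0 p1 Vn FL L_disj L_leaf room uzs zsE szs) _.
have h0' : 0 < h%:R :> R by rewrite ltr0n.
apply: le_trans (@potential_le R V z0 _ zs (2 / kappa) (4^-1 ^+ h) _ _ _) _; last first.
- rewrite mulrA; have -> : 2 * 2 = 4 :> R by lra.
  rewrite lerD2l; apply: le_trans (_ : (2 * h)%N%:R * 4^-1 ^+ h <= _).
    by rewrite ler_wpM2r ?exprn_ge0 ?invr_ge0 ?ler_nat.
  have h2 : h%:R <= 2 ^+ h :> R by rewrite -natrX ler_nat ltnW// ltn_expl.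
  have -> : 4^-1 = 2^-1 * 2^-1 :> R by lra.
  have i0 : 0 <= 2^-1 ^+ h :> R by rewrite exprn_ge0// invr_ge0.
  have i1 : 2 ^+ h * 2^-1 ^+ h = 1 :> R by rewrite -exprMn mulfV ?pnatr_eq0// expr1n.
  rewrite exprMn natrM ler_pdivlMr//.
  move: i0 i1 h2; move: (2^-1 ^+ h) (2 ^+ h) (h%:R : R) h0' => x y z z0' x0 yx zy.
  have h3 : z * x <= 1 by rewrite -yx ler_wpM2r.
  have h4 : (z * x) * (z * x) <= 1 * 1.
    by rewrite ler_pM// mulr_ge0// ltW.
  lra.
- move=> j jz; set a := #|L (nth z0 zs j)|.
  have zj : nth z0 zs j \in zs by rewrite mem_nth.
  have a1 : (0 < a)%N by rewrite card_gt0 -zsE.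
  have a2 : (a <= 2 * h)%N.
    apply: leq_trans cL; apply: subset_leq_card; apply/subsetP => v vL.
    by rewrite inE; apply/existsP; exists (nth z0 zs j).
  have a0' : 0 < a%:R :> R by rewrite ltr0n.
  set P := tail p (16 * h) a.
  have P0 : 0 <= P by exact: tail_ge0.
  have P1 : P <= 1 by exact: tail_le1.
  have [big|small] := lerP (16 * a%:R) ((16 * h)%N%:R * p).
    (* Each row fits the star with probability at least one half, and [(3 / 4) ^+ (32 * h)] beats
       [2 ^+ (2 * h)]. *)
    have P2 := tail_half p0 p1 a1 big; rewrite -/P in P2.
    apply: le_trans (_ : 4^-1 ^+ h <= _); last first.
      by rewrite lerDr exprn_ge0// divr_ge0// ltW.
    apply: le_trans (_ : 2 ^+ (2 * h) * (3 / 4) ^+ (32 * h) <= _).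
      apply: ler_pM; rewrite ?exprn_ge0//; first lra.
        by apply: ler_weXn2l; [lra | exact: leq_trans jz czs].
      by apply: lerXn2r; rewrite ?nnegrE; lra.
    have num : 2 ^+ 2 * (3 / 4) ^+ 32 <= 4^-1 :> R.
      apply: le_trans (_ : 2 ^+ 2 * (3 / 4) ^+ 10 <= _); last by lra.
      by rewrite ler_wpM2l ?exprn_ge0// ler_wiXn2l//; lra.
    rewrite expr_pairM.
    apply: lerXn2r num; rewrite nnegrE.
      by rewrite mulr_ge0 ?exprn_ge0//; lra.
    by rewrite invr_ge0.
  have aa : (0 < a <= 16 * h)%N by rewrite a1/=; apply: leq_trans a2 _; rewrite leq_mul2r orbT.
  have P2 := tail_block p0 p1 aa (ltW small); rewrite -/P in P2.
  have n0 : 0 < n%:R :> R.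
    by rewrite ltr0n; case/andP: hn => hn' _; apply: leq_trans hn'; rewrite muln_gt0.
  (* Here 272 is [34 * 128 / 16], by [n <= 128 * h]; and [2176 = 8 * 272] in [star_p]. *)
  have P3 : (p * n%:R / (272 * a%:R)) ^+ a <= P.
    apply: le_trans P2; apply: lerXn2r; rewrite ?nnegrE ?divr_ge0 ?mulr_ge0 ?(ltW a0') ?(ltW n0)//.
    rewrite ler_pdivrMr ?mulr_gt0//.
    have -> : p * (16 * h)%:R / (34 * a%:R) * (272 * a%:R) = p * (128 * h)%:R.
      by rewrite !natrM; field; rewrite gt_eqF.
    by rewrite ler_wpM2l// ler_nat; case/andP: hn.
  have P4 : 8 * kappa * j.+1%:R <= n%:R * P.
    apply: le_trans (_ : n%:R * (p * n%:R / (272 * a%:R)) ^+ a <= _); last first.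
      by rewrite ler_wpM2l// ltW.
    have -> : n%:R * (p * n%:R / (272 * a%:R)) ^+ a = p ^+ a * n%:R ^+ a.+1 / (272 * a%:R) ^+ a.
      by rewrite expr_div_n exprMn exprS; move: (p ^+ a) (n%:R ^+ a) (_ ^+ a) => x y z; ring.
    rewrite ler_pdivlMr ?exprn_gt0 ?mulr_gt0//; apply: le_trans (star_p z0 jz).
    rewrite -/a; have -> : 2176 * kappa * a%:R = (8 * kappa) * (272 * a%:R) by ring.
    have : 0 <= 272 * a%:R :> R by rewrite mulr_ge0// ltW.
    move: (272 * a%:R) => c c0; rewrite exprMn [leRHS]mulrAC ler_wpM2r ?exprn_ge0//.
    by rewrite ler_wpM2r// -[leLHS]expr1 ler_weXn2l//; lra.
  have P5 : kappa * j.+1%:R <= (32 * h)%:R * (2^-1 * P).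
    have : n%:R * P <= (128 * h)%:R * P by rewrite ler_wpM2r// ler_nat; case/andP: hn.
    rewrite !natrM; move: P4; have -> : 8 * kappa * j.+1%:R = 8 * (kappa * j.+1%:R) by ring.
    by move: (n%:R * P) (kappa * _) => x y; lra.
  apply: le_trans (_ : (2 / kappa) ^+ j.+1 <= _); last by rewrite lerDl exprn_ge0// invr_ge0.
  rewrite exprMn ler_wpM2l ?exprn_ge0//.
  apply: le_trans (expr1B_le _ _) _; first lra.
  apply: le_trans (_ : expR (- kappa) ^+ j.+1 <= _).
    by rewrite -expRM_natl ler_expR mulrN lerN2 mulrC.
  apply: lerXn2r; rewrite ?nnegrE ?expR_ge0 ?invr_ge0 ?(ltW k0)//.
  rewrite expRN lef_pV2 ?posrE ?expR_gt0//.
  by apply: le_trans (expR_ge1Dx _); lra.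
- by rewrite ler_pdivrMr//; lra.
- by rewrite divr_ge0// ltW.
Qed.

End StarHosts.

(** * Degeneracy *)

Section Degeneracy.
Variables (V : finType) (H : graph V).

(** The definition of degeneracy is applied to the subgraph induced on [U]. *)
Let low_degree (U : {set V}) : U != set0 ->
  exists2 v, v \in U & (#|[set w in U | adj H v w]| <= degen H)%N.
Proof.
move=> U0; pose F := [set e in H | val e \subset U].
have adjF v w : v \in U -> w \in U -> adj F v w = adj H v w.
  move=> vU wU; apply/adjP/adjP => -[e eF ee]; exists e => //.
    by move: eF; rewrite inE => /andP[].
  by rewrite inE eF ee subUset !sub1set vU.
rewrite /degen; case: ex_minnP => d dH _.
have mindeg : (min_degree U F <= d)%N.
  have := dH => /forallP/(_ U)/forallP/(_ F)/implyP; apply; rewrite U0 /=.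
  apply/andP; split; first by apply/subsetP => e; rewrite inE => /andP[].
  by apply/forallP => e; apply/implyP; rewrite inE => /andP[].
apply/exists_inP; apply: contraLR mindeg => noU; rewrite -ltnNge.
have dU v : v \in U -> (d < degree F v)%N.
  move=> vU; move: noU; rewrite negb_exists_in => /forall_inP/(_ v vU).
  rewrite -ltnNge => /leq_trans; apply; apply: subset_leq_card; apply/subsetP => w.
  by rewrite !inE => /andP[wU]; rewrite adjF.
apply: (big_ind (fun m => (d < m)%N)) => //.
- by case/set0Pn: U0 => v /dU /leq_trans; apply; apply: max_card.
- by move=> x y dx dy; rewrite leq_min dx.
Qed.

(** A vertex of low degree in [U] is put last and the others are ordered by induction. *)
Lemma degeneracy_order : exists rank : V -> nat,
  [/\ injective rank, forall v, (rank v < #|V|)%N &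
  forall v, (#|[set u | adj H u v & (rank u < rank v)%N]| <= degen H)%N].
Proof.
suff : forall m (U : {set V}), #|U| = m -> exists rank : V -> nat,
    [/\ {in U &, injective rank}, {in U, forall v, (rank v < m)%N} &
    {in U, forall v, #|[set u in U | adj H u v & (rank u < rank v)%N]| <= degen H}%N].
  move=> /(_ _ setT erefl)[rank [rinj rlt rdeg]]; exists rank; split.
  - by move=> u v; apply: rinj; rewrite inE.
  - by move=> v; rewrite -cardsT; apply: rlt; rewrite inE.
  move=> v; apply: leq_trans (rdeg v (in_setT v)); apply: eq_leq; apply: eq_card => u.
  by rewrite !inE.
elim=> [|m IH] U cU.
  by exists (fun=> 0%N); split=> v; rewrite (cards0_eq cU) inE.
have [|v vU vdeg] := @low_degree U; first by rewrite -card_gt0 cU.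
have cU' : #|U :\ v| = m by move: cU; rewrite (cardsD1 v) vU add1n => -[].
have [rank [rinj rlt rdeg]] := IH _ cU'.
pose r x := if x == v then m else rank x.
have rv : r v = m by rewrite /r eqxx.
have rE x : x != v -> r x = rank x by rewrite /r => /negbTE->.
exists r; split.
- move=> x y xU yU; have [->|xv] := eqVneq x v; have [->|yv] := eqVneq y v => //.
  + rewrite rv (rE _ yv) => h; have := rlt y; rewrite !inE yv yU h ltnn => /(_ isT).
    by [].
  + rewrite rv (rE _ xv) => h; have := rlt x; rewrite !inE xv xU -h ltnn => /(_ isT).
    by [].
  + by rewrite !rE//; apply: rinj; rewrite !inE ?xv ?yv.
- move=> x xU; have [->|xv] := eqVneq x v; first by rewrite rv.
  by rewrite rE// ltnS ltnW// rlt// !inE xv.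
- move=> x xU; have [->|xv] := eqVneq x v.
    apply: leq_trans vdeg; apply: subset_leq_card; apply/subsetP => u.
    by rewrite !inE adj_sym => /and3P[-> ->].
  have xU' : x \in U :\ v by rewrite !inE xv.
  apply: leq_trans (rdeg x xU'); apply: subset_leq_card; apply/subsetP => u.
  rewrite !inE => /and3P[uU ux]; rewrite (rE x xv).
  have [->|uv] := eqVneq u v; last by rewrite rE// => ->; rewrite uU ux.
  by rewrite rv ltnNge ltnW// rlt.
Qed.

(** Minimality of the degeneracy gives a subgraph of minimum degree at least [degen H]; its degrees
    sum to at most twice its number of edges. *)
Lemma degen_dense_subgraph : (0 < degen H)%N -> exists (U : {set V}) (F : graph V),
  [/\ U != set0, F \subset H, forall e, e \in F -> val e \subset U &
      (#|U| * degen H <= 2 * #|F|)%N].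
Proof.
rewrite /degen; case: ex_minnP => d _ dmin d0.
have /forallPn[U /forallPn[F]] : ~~ degen_le H d.-1.
  by apply/negP => /dmin; rewrite -ltnS prednK// ltnn.
rewrite negb_imply => /andP[/andP[U0 /andP[FH /forall_inP FU]]]; rewrite -ltnNge prednK// => mind.
exists U, F; split=> //.
have degd v : v \in U -> (d <= degree F v)%N.
  move=> vU; apply: leq_trans mind _; rewrite /min_degree.
  elim: (index_enum V) (mem_index_enum v) => // x r IH.
  rewrite inE big_cons => /orP[/eqP<-|/IH le_r]; first by rewrite vU geq_minl.
  by case: ifP => // _; apply: leq_trans (geq_minr _ _) le_r.
rewrite -sum_nat_const; apply: leq_trans (leq_sum _ degd) _.
apply: leq_trans (_ : \sum_(v in U) \sum_(e in F) (v \in val e) <= _)%N.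
  apply: leq_sum => v vU; rewrite -big_mkcondr/= sum1dep_card.
  rewrite -[X in (_ <= X)%N](card_imset _ val_inj) /degree.
  rewrite -(@card_in_imset _ _ (fun w => [set v; w])); last first.
    move=> w w'; rewrite !inE => /adj_neq vw _ /set2_cases[[]|[_ h]] //.
    by rewrite h eqxx in vw.
  apply: subset_leq_card; apply/subsetP => A /imsetP[w]; rewrite inE => /adjP[e eF ee] ->.
  by apply/imsetP; exists e; rewrite ?inE ?eF ?ee ?set21.
rewrite exchange_big/= mulnC -sum_nat_const; apply: leq_sum => e eF.
apply: leq_trans (_ : #|val e| <= _)%N; last by rewrite (eqP (valP e)).
rewrite -sum1_card [leqRHS]big_mkcond/= [leqLHS]big_mkcond/=.
by apply: leq_sum => v _; case: (v \in U).
Qed.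

End Degeneracy.

(** A dense subgraph [F] on [U] has at most [n ^ #|U|] copies, and [#|U| <= 2 * #|F| / d]. So at
    [p = y / 2] their expected number is at most [2^-1 ^+ #|F|]. *)
Lemma degeneracy_expectation (R : realType) (V : finType) (n : nat) (H : graph V) :
  (0 < degen H)%N -> (0 < n)%N ->
  2^-1 * n%:R `^ (- (2 / (degen H)%:R)) <= expectation_threshold R (containing n H).
Proof.
move=> d0 n0; have [U [F [U0 FH FU cUF]]] := degen_dense_subgraph d0.
set d := degen H in d0 cUF *; pose y : R := n%:R `^ (- (2 / d%:R)).
have n1 : 1 <= n%:R :> R by rewrite ler1n.
have d0' : 0 < d%:R :> R by rewrite ltr0n.
have y0 : 0 <= y by exact: powR_ge0.
have y1 : y <= 1.
  by rewrite -(powRr0 n%:R) ler_powR// oppr_le0 divr_ge0// ltW.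
have F0 : (0 < #|F|)%N.
  have : (0 < #|U| * d)%N by rewrite muln_gt0 card_gt0 U0.
  by move=> /leq_trans/(_ cUF); rewrite muln_gt0.
have cc : (#|copies n F| <= n ^ #|U|)%N.
  pose x0 := Ordinal n0.
  apply: leq_trans (_ : #|[set img (g : {ffun V -> 'I_n}) F | g in pffun_on x0 (mem U) predT]| <= _)%N.
    apply: subset_leq_card; apply/subsetP => _ /imsetP[f _ ->].
    apply/imsetP; exists [ffun v => if v \in U then f v else x0].
      apply/pffun_onP; split=> //; apply/subsetP => v; rewrite unfold_in ffunE.
      by case: ifP => //; rewrite eqxx.
    apply/setP => e; rewrite !inE; apply: eq_existsb => e0.
    case: (boolP (e0 \in F)) => //= e0F; congr (_ == _); apply: eq_in_imset => v ve.
    by rewrite ffunE (subsetP (FU _ e0F)).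
  by apply: leq_trans (leq_imset_card _ _) _; rewrite card_pffun_on !card_ord.
have := @expectation_threshold_copies R V n H F (2^-1 * y) FH; apply.
  by rewrite mulr_ge0 ?invr_ge0//= mulr_ile1 ?invr_ge0//; lra.
apply: le_trans (_ : (n ^ #|U|)%N%:R * (2^-1 * y) ^+ #|F| <= _).
  by rewrite ler_wpM2r ?ler_nat// exprn_ge0// mulr_ge0 ?invr_ge0.
rewrite exprMn mulrCA; have h : 2^-1 ^+ #|F| <= 2^-1 :> R.
  case: #|F| F0 => // m _; rewrite exprS ler_piMr ?invr_ge0// exprn_ile1 ?invr_ge0//; lra.
rewrite -[leRHS]mulr1; apply: ler_pM => //.
- by rewrite mulr_ge0// exprn_ge0.
rewrite natrX -powR_mulrn ?ler0n// -[X in _ * X]powR_mulrn// -powRrM -powRD; last first.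
  by rewrite (gt_eqF (lt_le_trans ltr01 n1)) implybT.
rewrite -[leRHS](powRr0 n%:R) ler_powR//.
have : (#|U|%:R * d%:R <= 2 * #|F|%:R :> R) by rewrite -!natrM ler_nat.
rewrite mulNr subr_le0 mulrAC ler_pdivlMr//.
Qed.

(** Within a residue class, [r u] is determined by its quotient by [k]. *)
Lemma card_residue (V : finType) (B : {set V}) (r : V -> nat) (N k i : nat) : (0 < k)%N ->
  {in B &, injective r} -> (forall u, u \in B -> r u < N)%N ->
  (#|[set u in B | r u %% k == i]| <= (N %/ k).+1)%N.
Proof.
move=> k0 rinj rN; set S := [set u in B | _].
pose f u : 'I_(N %/ k).+1 := inord (r u %/ k).
have fE u : u \in S -> (f u : nat) = (r u %/ k)%N.
  by rewrite inE => /andP[/rN uN _]; rewrite inordK// ltnS leq_div2r// ltnW.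
rewrite -[X in (_ <= X)%N]card_ord -(@card_in_imset _ _ f); first exact: max_card.
move=> u v uS vS /(congr1 (@nat_of_ord _)); rewrite !fE// => uv.
move: uS vS; rewrite !inE => /andP[uB /eqP ui] /andP[vB /eqP vi]; apply: rinj => //.
by rewrite (divn_eq (r u) k) (divn_eq (r v) k) uv ui vi.
Qed.

(** With at most one parent each, vertices can be coloured in order of rank, opposite to the
    parent. *)
Lemma parent_coloring (V : finType) (P : V -> {set V}) (rank : V -> nat) :
  (forall u v, u \in P v -> (rank u < rank v)%N) -> (forall v, (#|P v| <= 1)%N) ->
  exists col : V -> bool, forall u v, u \in P v -> col u != col v.
Proof.
move=> Pr P1; suff H m : exists col : V -> bool,
    forall u v, (rank v < m)%N -> u \in P v -> col u != col v.
  have [col Hcol] := H (\max_v rank v).+1; exists col => u v; apply: Hcol.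
  by rewrite ltnS; apply: leq_bigmax.
elim: m => [|m [col Hcol]]; first by exists (fun=> true).
exists (fun x => if rank x == m then (if [pick u in P x] is Some u then ~~ col u else true) else col x).
move=> u v; rewrite ltnS leq_eqVlt => vm uv; have := Pr _ _ uv.
case: (eqVneq (rank v) m) vm => [-> _ um|vm /= vm' uv'].
  rewrite ltn_eqF//; case: pickP => [w wP|/(_ u)]; last by rewrite uv.
  have -> : w = u by apply: (card_le1_eqP (P1 v)).
  by case: (col u).
by rewrite ltn_eqF ?(ltn_trans uv')//; apply: Hcol.
Qed.

Lemma degen_gt0 (V : finType) (H : graph V) : H != set0 -> (0 < degen H)%N.
Proof.
case/set0Pn => e eH; have [x [y [xy ee]]] := vpairP e.
have [rank [rinj _ rdeg]] := degeneracy_order H.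
rewrite lt0n; apply/eqP => d0.
have noback u v : adj H u v -> (rank v <= rank u)%N.
  move=> uv; rewrite leqNgt; apply/negP => ruv; have := rdeg v; rewrite d0 leqn0.
  by move=> /eqP/cards0_eq/setP/(_ u); rewrite !inE uv ruv.
have axy : adj H x y by rewrite (adj_val H ee).
move/eqP: xy; apply; apply: rinj; apply/eqP.
by rewrite eqn_leq noback ?[adj H y x]adj_sym// noback.
Qed.

(** * Pieces *)

(** Carries the bound of [star_expectation_threshold], with [c = 32], over to the probability
    [L * q] with the extra factor [w] that [star_hosts] asks for. *)
Lemma scaled_power_le (R : realType) (w c L q m x y : R) a : 0 <= w -> 0 <= c -> 0 <= q -> 0 <= m ->
  c * w <= L -> x ^+ a * y <= (c * q) ^+ a * m -> (w * x) ^+ a * y <= (L * q) ^+ a * m.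
Proof.
move=> w0 c0 q0 m0 cwL h; rewrite exprMn -mulrA.
apply: le_trans (ler_wpM2l (exprn_ge0 a w0) h) _; rewrite mulrA -exprMn ler_wpM2r//.
apply: lerXn2r; rewrite ?nnegrE; first by rewrite !mulr_ge0.
  by rewrite mulr_ge0//; apply: le_trans cwL; rewrite mulr_ge0.
by rewrite mulrA [w * c]mulrC ler_wpM2r.
Qed.

Section Pieces.
Variables (R : realType) (V : finType) (H : graph V) (n k0 : nat) (rank : V -> nat).
Variable (col : 'I_k0 -> V -> bool).
Hypotheses (k0_gt0 : (0 < k0)%N) (Vn : (#|V| <= n)%N).
Hypotheses (rank_inj : injective rank) (rank_lt : forall v, (rank v < #|V|)%N)
  (rank_deg : forall v, (#|[set u | adj H u v & (rank u < rank v)%N]| <= degen H)%N).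

Definition back v := [set u | adj H u v & (rank u < rank v)%N].

Definition back_group (i : 'I_k0) v := [set u in back v | (index u (enum (back v)) %% k0)%N == i].

(* A piece is determined by the residues mod 64 of the ranks of the parent and of
   the child, by the group of the parent and by the colour of the child. *)
Definition piece_index : finType := ('I_64 * 'I_64 * 'I_k0 * bool)%type.

Definition parents (j : piece_index) v :=
  [set u in back_group j.1.2 v | [&& (rank u %% 64)%N == j.1.1.1, (rank v %% 64)%N == j.1.1.2
                              & col j.1.2 v == j.2]].

Definition piece (j : piece_index) : graph V :=
  [set e in H | [exists v, exists u in parents j v, val e == [set u; v]]].

Lemma backP u v : u \in back v -> adj H u v /\ (rank u < rank v)%N.
Proof. by rewrite inE => /andP[]. Qed.

Lemma group_back i u v : u \in back_group i v -> u \in back v.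
Proof. by rewrite [u \in back_group _ _]inE => /andP[]. Qed.

Lemma parents_group j u v : u \in parents j v -> u \in back_group j.1.2 v.
Proof. by rewrite [u \in parents _ _]inE => /andP[]. Qed.

Lemma parents_back j u v : u \in parents j v -> u \in back v.
Proof. by move=> /parents_group/group_back. Qed.

Lemma card_group i v : (#|back_group i v| <= (degen H %/ k0).+1)%N.
Proof.
apply: card_residue => // [u w uB wB /(congr1 (nth u (enum (back v))))|u uB].
  by rewrite !nth_index ?mem_enum.
by apply: leq_trans (rank_deg v); rewrite [X in (_ < X)%N]cardE index_mem mem_enum.
Qed.

Lemma card_parents j v : (#|parents j v| <= (degen H %/ k0).+1)%N.
Proof.
apply: leq_trans (card_group j.1.2 v); apply: subset_leq_card.
by apply/subsetP => u /parents_group.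
Qed.

Lemma card_children j u : (#|[set v | u \in parents j v]| <= max_degree H)%N.
Proof.
apply: leq_trans (_ : degree H u <= _)%N; last exact: leq_bigmax.
apply: subset_leq_card; apply/subsetP => v.
by rewrite inE => /parents_back/backP[uv _]; rewrite inE.
Qed.

Lemma adj_piece j x y : adj (piece j) x y -> x \in parents j y \/ y \in parents j x.
Proof.
move=> /adjP[e]; rewrite inE => /andP[_ /existsP[v /existsP[u /andP[uP /eqP ee]]]].
by rewrite ee => /set2_cases[[<- <-]|[<- <-]]; [left|right].
Qed.

Lemma piece_cover : H \subset \bigcup_j piece j.
Proof.
apply/subsetP => e eH; have [x0 [y0 [xy0 ee0]]] := vpairP e.
have {x0 y0 xy0 ee0} [x [y [ee rxy]]] : exists x y, val e = [set x; y] /\ (rank x < rank y)%N.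
  case: (ltngtP (rank x0) (rank y0)) => [lt|lt|/rank_inj h].
  - by exists x0, y0.
  - by exists y0, x0; rewrite setUC.
  - by rewrite h eqxx in xy0.
have xB : x \in back y by rewrite inE rxy (adj_val H ee) eH.
have m64 m : (m %% 64 < 64)%N by rewrite ltn_mod.
have mk m : (m %% k0 < k0)%N by rewrite ltn_mod.
pose i := Ordinal (mk (index x (enum (back y)))).
pose j : piece_index := (Ordinal (m64 (rank x)), Ordinal (m64 (rank y)), i, col i y).
apply/bigcupP; exists j => //; rewrite inE eH; apply/existsP; exists y; apply/existsP; exists x.
rewrite ee eqxx andbT !inE /= !eqxx !andbT; move: xB; rewrite inE => ->.
by [].
Qed.

(** Two residue classes containing all edges of the piece; they hold about [n / 32] vertices. *)
Definition active (j : piece_index) := [set v | ((rank v %% 64)%N == j.1.1.1) || ((rank v %% 64)%N == j.1.1.2)] : {set V}.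

Lemma card_class (i : nat) : (#|[set v | (rank v %% 64)%N == i]| <= (n %/ 64).+1)%N.
Proof.
have := @card_residue V setT rank n 64 i isT (in2W rank_inj).
move=> bound; apply: leq_trans (bound _); last by move=> v _; apply: leq_trans (rank_lt v) Vn.
by apply: subset_leq_card; apply/subsetP => v; rewrite !inE.
Qed.

Lemma card_active j : (#|active j| <= 2 * (n %/ 64).+1)%N.
Proof.
have -> : active j = [set v | (rank v %% 64)%N == j.1.1.1] :|: [set v | (rank v %% 64)%N == j.1.1.2].
  by apply/setP => v; rewrite !inE.
by apply: leq_trans (leq_card_setU _ _) _; rewrite mul2n -addnn leq_add ?card_class.
Qed.

Lemma parents_active j u v : u \in parents j v -> u \in active j /\ v \in active j.
Proof. by rewrite !inE => /and4P[_ -> -> _]; rewrite orbT. Qed.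

Lemma greedy_piece (p : R) s j : 0 <= p -> p <= 1 ->
  (2 * (n %/ 64).+1 + (degen H %/ k0).+1 * (s * max_degree H) + s <= n)%N ->
  1 - mu p (hosts n (piece j)) <= n%:R * (1 - p ^+ (degen H %/ k0).+1) ^+ s.
Proof.
move=> p0 p1 room.
apply: le_trans (@greedy_embedding _ p V n (degen H %/ k0).+1 (max_degree H) s (parents j)
  rank (piece j) (active j) p0 p1 Vn _ _ _ _ _ _) _.
- by move=> u v /parents_back/backP[].
- exact: adj_piece.
- exact: parents_active.
- exact: card_parents.
- exact: card_children.
- by apply: leq_trans room; rewrite !leq_add2r card_active.
rewrite ler_wpM2r//; last first.
  by rewrite ler_nat (leq_trans (max_card _) Vn).
by rewrite exprn_ge0// subr_ge0 exprn_ile1.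
Qed.

Hypothesis col_proper : (degen H < k0)%N ->
  forall i u v, u \in back_group i v -> col i u != col i v.

(** As [degen H < k0], a vertex has at most one parent in the piece. All children have colour [j.2]
    and parents the other colour, so no child is a parent: the piece is a star forest. *)
Lemma star_piece (p kappa L : R) j : let q := expectation_threshold R (containing n H) in
  (degen H < k0)%N -> 4 <= kappa -> 0 <= q -> 32 * 2176 * kappa <= L -> L * q <= 1 ->
  (64 <= n)%N ->
  1 - mu (L * q) (hosts n (piece j)) <= 4 / kappa + 2 / (n %/ 64)%:R.
Proof.
move=> q dk kappa4 q0 L0 p1 n64.
pose Lv z := [set v | z \in parents j v].
have h0 : (0 < n %/ 64)%N by rewrite divn_gt0.
have par1 v u u' : u \in parents j v -> u' \in parents j v -> u = u'.
  have : (#|parents j v| <= 1)%N by have := card_parents j v; rewrite divn_small.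
  by move=> /card_le1_eqP h uv u'v; apply: h.
have Ldisj z z' v : v \in Lv z -> v \in Lv z' -> z = z'.
  by move=> h h'; move: h h'; rewrite inE => h; rewrite inE; apply: par1.
have Lleaf z v : v \in Lv z -> Lv v = set0.
  rewrite inE => zv; apply/setP => w; rewrite [w \in Lv v]inE in_set0; apply/negP => vw.
  have := col_proper dk (parents_group vw).
  move: zv vw; rewrite !inE => /and4P[_ _ _ /eqP->] /and4P[_ _ _ /eqP->].
  by rewrite eqxx.
have LH z v : v \in Lv z -> adj H z v by rewrite inE => /parents_back/backP[].
have h2 : ((n %/ 64).+1 <= 2 * (n %/ 64))%N.
  by move: h0; move: (n %/ 64)%N => h; clear; lia.
pose zs := sort (fun x y => (#|Lv y| <= #|Lv x|)%N) (enum [set z | Lv z != set0]).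
have uzs : uniq zs by rewrite sort_uniq enum_uniq.
have zsE z : (z \in zs) = (Lv z != set0) by rewrite mem_sort mem_enum inE.
have szs : sorted (fun x y => (#|Lv y| <= #|Lv x|)%N) zs.
  by apply: sort_sorted => x y; apply: leq_total.
have p0 : 0 <= L * q by rewrite mulr_ge0//; lra.
have c0 : 0 <= 2176 * kappa by lra.
apply: (@star_hosts R (L * q) kappa V n (n %/ 64) Lv (piece j) zs) => //.
- by move=> x y /adj_piece[h|h]; [left|right]; rewrite inE.
- have := divn_eq n 64; have := ltn_mod n 64; move: h0; move: (n %/ 64)%N (n %% 64)%N => h m.
  by clear; lia.
- apply: leq_trans h2; apply: leq_trans (card_class j.1.1.2); apply: subset_leq_card.
  by apply/subsetP => v; rewrite !inE => /existsP[z]; rewrite !inE => /and4P[].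
- apply: leq_trans h2; apply: leq_trans (card_class j.1.1.1).
  rewrite size_sort -cardE; apply: subset_leq_card; apply/subsetP => z.
  rewrite inE => /set0Pn[v]; rewrite !inE => /and4P[_ h _ _]; exact: h.
move=> z0 i isz; set a := #|_|; cbv zeta.
(* The [i.+1] largest stars; the list being sorted, each has at least [a] leaves. *)
pose Z := [set z in take i.+1 zs].
have cZ : #|Z| = i.+1.
  by rewrite cardsE (card_uniqP _) ?take_uniq// size_takel.
have a0 : (0 < a)%N by rewrite card_gt0 -zsE mem_nth.
have La z : z \in Z -> (a <= #|Lv z|)%N.
  rewrite inE => /(nthP z0)[i' ]; rewrite size_takel// => i'i <-.
  rewrite nth_take//; move: i'i; rewrite ltnS => i'i.
  have tr : transitive (fun x y => (#|Lv y| <= #|Lv x|)%N).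
    by move=> x y z' h1 h3; apply: leq_trans h3 h1.
  apply: (sorted_leq_nth tr _ _ szs) => //; rewrite ?inE//.
  exact: leq_ltn_trans i'i isz.
have Z0 : (0 < #|Z|)%N by rewrite cZ.
have [_] := @star_expectation_threshold R V n H Lv Z a Vn Lleaf LH a0 Z0 La.
rewrite cZ -/q => hq; apply: scaled_power_le hq => //; last by rewrite mulrA.
Qed.

End Pieces.

(** * Choice of the parameters *)

(** With [y = n ^ (e / 8)], [ln n = (8 / e) * ln y <= (8 / e) * y]. The square costs
    [K * n ^ (e / 4)], and [K <= n ^ (e / 4)] for large [n]. *)
Lemma ln_sq_le_powR (R : realType) (e : R) : 0 < e -> exists N : nat, forall n : nat,
  (N <= n)%N -> 1 <= ln n%:R :> R /\ 12 * ln (n%:R : R) ^+ 2 <= n%:R `^ (e / 2).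
Proof.
move=> e0; pose K : R := 12 * (8 / e) ^+ 2.
have e8 : 0 < 8 / e by rewrite divr_gt0.
have K0 : 0 <= K by rewrite mulr_ge0// exprn_ge0// ltW.
have KK : 0 <= K `^ (4 / e) by exact: powR_ge0.
exists (maxn 4 (Num.bound (K `^ (4 / e)))) => n; rewrite geq_max => /andP[n4 nK].
have x4 : 4 <= n%:R :> R by rewrite (ler_nat R 4).
have x0 : 0 < n%:R :> R by lra.
split.
  rewrite -[leLHS](expRK (1 : R)) ler_ln ?posrE ?expR_gt0//.
  by apply: le_trans (expR1_le4 R) x4.
have Kx : K <= n%:R `^ (e / 4).
  have h : K `^ (4 / e) <= n%:R.
    by apply: le_trans (ltW (archi_boundP KK)) _; rewrite ler_nat.
  have e4 : 0 <= e / 4 by rewrite divr_ge0// ltW.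
  have := ge0_ler_powR e4 _ _ h; rewrite -powRrM.
  have -> : 4 / e * (e / 4) = 1 by field; rewrite gt_eqF.
  by rewrite powRr1//; apply; rewrite nnegrE// ltW.
pose y : R := n%:R `^ (e / 8).
have y0 : 0 < y by exact: powR_gt0.
have lnx : ln (n%:R : R) = 8 / e * ln y.
  by rewrite /y ln_powR mulrA; have -> : 8 / e * (e / 8) = 1 by [field; rewrite gt_eqF]; rewrite mul1r.
have ln0 : 0 <= ln (n%:R : R) by apply: ln_ge0; lra.
have lny : ln (n%:R : R) <= 8 / e * y.
  by rewrite lnx ler_pM2l// ltW// ln_sublinear.
have y2 : y ^+ 2 = n%:R `^ (e / 4).
  rewrite -powR_mulrn ?ltW// -powRrM; congr (_ `^ _); lra.
have -> : n%:R `^ (e / 2) = n%:R `^ (e / 4) * n%:R `^ (e / 4) :> R.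
  rewrite -powRD; last by rewrite (gt_eqF x0) implybT.
  by congr (_ `^ _); lra.
apply: le_trans (_ : K * y ^+ 2 <= _); last by rewrite y2 ler_wpM2r// powR_ge0.
have e8y : 0 <= 8 / e * y by rewrite mulr_ge0// ltW.
rewrite /K -mulrA -exprMn ler_wpM2l//.
by apply: lerXn2r; rewrite ?nnegrE.
Qed.

Section GreedyParameters.
Variables (R : realType) (n d k0 Delta : nat) (e p : R).

Lemma greedy_parameters : 0 < e -> e <= 1 -> 8 / e <= k0%:R -> (k0 <= d)%N ->
  d%:R <= ln (n%:R : R) -> 1 <= ln (n%:R : R) ->
  12 * ln (n%:R : R) ^+ 2 <= n%:R `^ (e / 2) -> Delta%:R <= n%:R `^ (1 - e) :> R ->
  n%:R `^ (- (2 / d%:R)) <= p -> p <= 1 -> (8 <= n)%N ->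
  exists s, (2 * (n %/ 64).+1 + (d %/ k0).+1 * (s * Delta) + s <= n)%N /\
    n%:R * (1 - p ^+ (d %/ k0).+1) ^+ s <= n%:R^-1.
Proof.
move=> e0 e1 k0e k0d dl l1 l2 De yp p1 n8.
have x8 : 8 <= n%:R :> R by rewrite (ler_nat R 8).
have x0 : 0 < n%:R :> R by lra.
have x1 : 1 <= n%:R :> R by lra.
set l := ln _ in dl l1 l2; set u := _ `^ (e / 2) in l2; set w := _ `^ (1 - e) in De.
have u1 : 1 <= u by rewrite -[leLHS](powRr0 n%:R) ler_powR// divr_ge0// ltW.
have w1 : 1 <= w by rewrite -[leLHS](powRr0 n%:R) ler_powR// subr_ge0.
have uuw : u * u * w = n%:R.
  rewrite -!powRD ?(gt_eqF x0) ?implybT//.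
  have -> : e / 2 + e / 2 + (1 - e) = 1 by lra.
  by rewrite powRr1// ltW.
have e8 : 8 <= 8 / e by rewrite ler_pdivlMr//; lra.
have k8 : (8 <= k0)%N by rewrite -(ler_nat R); apply: le_trans k0e.
have k0' : 0 < k0%:R :> R by rewrite ltr0n; apply: leq_trans k8.
have d0 : 0 < d%:R :> R by rewrite ltr0n; apply: leq_trans k0d; apply: leq_trans k8.
set d' := (d %/ k0).+1.
have k0N : (0 < k0)%N by apply: leq_trans k8.
have dd : (d' * k0 <= 2 * d)%N.
  by rewrite /d' mulSn mul2n -addnn leq_add// leq_trunc_div.
have d'd : (d' <= d)%N.
  rewrite /d'; apply: leq_ltn_trans (_ : d %/ 2 < d)%N; first by apply: leq_div2l => //; apply: leq_trans k8.
  by apply: ltn_Pdiv => //; apply: leq_trans k0d.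
have T0 : 0 <= 2 * l * u by rewrite !mulr_ge0//; lra.
(* The witness [s0.+1] exceeds [2 * l * u]. A candidate succeeds with probability at least [u^-1],
   so all fail with probability at most [expR (- (2 * l))], that is [n ^ (- 2)]. *)
have /andP[s1 s2] := truncn_itv T0; set s0 := Num.trunc _ in s1 s2.
(* Indeed [d' * k0 <= 2 * d] and [8 / e <= k0] give [2 * d' / d <= e / 2]. *)
have pd : u^-1 <= p ^+ d'.
  apply: le_trans (_ : (n%:R `^ (- (2 / d%:R))) ^+ d' <= _); last first.
    by apply: lerXn2r; rewrite ?nnegrE ?powR_ge0//; apply: le_trans yp; exact: powR_ge0.
  rewrite -powR_mulrn ?powR_ge0// -powRrM /u -powRN ler_powR//.
  rewrite mulNr lerN2 mulrAC ler_pdivrMr//.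
  apply: le_trans (_ : 4 / k0%:R * d%:R <= _).
    rewrite mulrAC ler_pdivlMr// -mulrA -natrM.
    have : (d' * k0)%N%:R <= (2 * d)%N%:R :> R by rewrite ler_nat.
    by rewrite [(2 * d)%N%:R]natrM; move: ((d' * k0)%N%:R : R) (d%:R : R) => a b; lra.
  rewrite ler_wpM2r ?(ltW d0)// ler_pdivrMr//.
  have : 8 <= e * k0%:R by rewrite mulrC -ler_pdivrMr.
  by move: (k0%:R : R) => a; lra.
have u0 : 0 < u by lra.
exists s0.+1; split.
  have d'l : d'%:R <= l by apply: le_trans dl; rewrite ler_nat.
  have s3 : s0.+1%:R <= 3 * l * u.
    rewrite -natr1; apply: le_trans (_ : 2 * l * u + 1 <= _); first by rewrite lerD2r.
    have : 1 <= l * u by rewrite mulr_ege1.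
    by rewrite -!mulrA; move: (l * u) => a; lra.
  have lu0 : 0 <= 3 * l * u by rewrite !mulr_ge0//; lra.
  have A : d'%:R * (s0.+1%:R * Delta%:R) <= l * (3 * l * u * w) by rewrite !ler_pM ?mulr_ge0.
  have B : 3 * l * u <= l * (3 * l * u * w).
    have -> : l * (3 * l * u * w) = (l * w) * (3 * l * u) by ring.
    by rewrite ler_peMl// mulr_ege1.
  (* From [12 * l ^+ 2 <= u] and [n = u * u * w]. *)
  have D : l * (3 * l * u * w) <= n%:R / 4.
    rewrite -uuw; have uw0 : 0 <= u * w by rewrite mulr_ge0//; lra.
    have := ler_wpM2r uw0 l2; have -> : l * (3 * l * u * w) = 3 * (l ^+ 2 * (u * w)) by ring.
    have -> : u * u * w = u * (u * w) by ring.
    by rewrite -mulrA; move: (l ^+ 2 * _) (u * (_ * _)) => a b; lra.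
  have E : (2 * (n %/ 64).+1)%N%:R <= n%:R / 2 :> R.
    have : (64 * (n %/ 64) <= n)%N by rewrite mulnC leq_trunc_div.
    rewrite -(ler_nat R) !natrM -[(n %/ 64).+1%:R]natr1; move: ((n %/ 64)%N%:R : R) x8 => a.
    by move: (n%:R : R) => b; lra.
  have A' : (d' * (s0.+1 * Delta))%N%:R <= n%:R / 4 :> R.
    by rewrite (natrM R d') (natrM R s0.+1); apply: le_trans A D.
  have B' : s0.+1%:R <= n%:R / 4 :> R by apply: le_trans s3 (le_trans B D).
  have add3 (a b c : nat) : a%:R <= n%:R / 2 :> R -> b%:R <= n%:R / 4 :> R ->
      c%:R <= n%:R / 4 :> R -> (a + b + c <= n)%N.
    by rewrite -(ler_nat R) !natrD; lra.
  exact: add3 E A' B'.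
have p0 : 0 <= p by apply: le_trans yp; exact: powR_ge0.
have pd1 : p ^+ d' <= 1 by rewrite exprn_ile1.
apply: le_trans (_ : n%:R * expR (- (s0.+1%:R * p ^+ d')) <= _).
  by rewrite ler_wpM2l ?(ltW x0)// expr1B_le.
have sp : 2 * l <= s0.+1%:R * p ^+ d'.
  apply: le_trans (_ : 2 * l * u * u^-1 <= _); first by rewrite mulfK// gt_eqF.
  by apply: ler_pM => //; [rewrite invr_ge0 ltW | exact: ltW].
apply: le_trans (_ : n%:R * expR (- (2 * l)) <= _).
  by rewrite ler_wpM2l ?(ltW x0)// ler_expR lerN2.
have -> : - (2 * l) = - l + - l by lra.
rewrite expRD expRN /l lnK ?posrE//.
by rewrite mulrA mulfV ?gt_eqF// mul1r.
Qed.

End GreedyParameters.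

(** Here [n ^ (2 / d) <= expR 2 <= 16]. *)
Lemma powR_log_ge (R : realType) (n d : nat) : (0 < n)%N -> (0 < d)%N ->
  ln (n%:R : R) <= d%:R -> 16^-1 <= n%:R `^ (- (2 / d%:R)) :> R.
Proof.
move=> n0 d0 nd; have d0' : 0 < d%:R :> R by rewrite ltr0n.
have n0' : 0 < n%:R :> R by rewrite ltr0n.
rewrite /powR (gt_eqF n0') mulNr expRN lef_pV2 ?posrE ?expR_gt0//.
apply: le_trans (_ : expR (1 + 1) <= _).
  rewrite ler_expR mulrAC ler_pdivrMr//.
  by move: (ln _) (d%:R : R) nd => a b; lra.
rewrite expRD; have -> : 16 = 4 * 4 :> R by lra.
by rewrite ler_pM ?expR_ge0 ?expR1_le4.
Qed.

(** * Assembly of the pieces *)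

Lemma graph_threshold_bound (R : realType) (eps : R) : 0 < eps ->
  exists (k : nat) (L : R), (0 < k)%N /\
    exists N : nat, forall n : nat, (N <= n)%N ->
      forall (V : finType) (H : graph V), (#|V| <= n)%N ->
        (max_degree H)%:R <= n%:R `^ (1 - eps) ->
        graph_k_threshold R k n H <= L * graph_expectation_threshold R n H.
Proof.
move=> eps0; pose e := Num.min eps 1.
have e0 : 0 < e by rewrite lt_min eps0/=.
have e1 : e <= 1 by rewrite ge_min lexx orbT.
have [N1 HN1] := ln_sq_le_powR e0.
have e8 : 0 <= 8 / e by rewrite divr_ge0// ltW.
pose k0 := Num.bound (8 / e).
have k0e : 8 / e <= k0%:R by exact: ltW (archi_boundP e8).
have k0N : (0 < k0)%N.
  rewrite -(ltr_nat R); apply: lt_le_trans k0e; by rewrite divr_gt0.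
pose k := #|piece_index k0|.
have k_gt0 : (0 < k)%N by rewrite /k !card_prod !card_ord card_bool !muln_gt0 k0N.
have kR : 1 <= k%:R :> R by rewrite ler1n.
(* Makes [4 / kappa] less than [1 / (4 * k)], half of the allowed failure probability; [L] is then
   the least value accepted by [star_piece]. *)
pose kappa : R := 16 * k%:R + 4.
pose L : R := 32 * 2176 * kappa.
exists k, L; split=> //; exists (maxn N1 (64 * (8 * k).+1)) => n.
rewrite geq_max => /andP[nN1 nk] V H Vn maxH.
have [l1 l2] := HN1 n nN1.
rewrite /graph_k_threshold /graph_expectation_threshold.
case: ifPn => [_|H0]; first by rewrite mulr0.
set q := expectation_threshold _ _.
have n64 : (64 <= n)%N by apply: leq_trans nk; rewrite leq_pmulr.
have n8 : (8 <= n)%N by apply: leq_trans n64.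
have n0 : (0 < n)%N by apply: leq_trans n8.
have d0 := degen_gt0 H0.
have yq := @degeneracy_expectation R V n H d0 n0; rewrite -/q in yq.
set d := degen H in d0 yq *.
set y := _ `^ _ in yq.
have y0 : 0 < y by rewrite powR_gt0 ?ltr0n.
have q0 : 0 <= q by lra.
have kap : 4 <= kappa by rewrite /kappa; lra.
have kap0 : 0 <= kappa by lra.
have L1 : 128 <= L.
  apply: le_trans (_ : 32 * 4 <= _); first by lra.
  by rewrite /L -mulrA ler_wpM2l//; apply: le_trans kap _; rewrite ler_peMl ?ler1n.
have [Lq|Lq] := lerP 1 (L * q); first by apply: le_trans (threshold_le1 R H Vn k_gt0) Lq.
have Lq0 : 0 <= L * q by rewrite mulr_ge0//; lra.
have Lqy : 64 * y <= L * q.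
  apply: le_trans (_ : 128 * (2^-1 * y) <= _); first by lra.
  by apply: ler_pM => //; lra.
have dl : d%:R <= ln (n%:R : R).
  (* Otherwise [y >= 1 / 16], against [64 * y <= L * q < 1]. *)
  rewrite leNgt; apply/negP => dl.
  have := powR_log_ge n0 d0 (ltW dl); rewrite -/y; lra.
have [rank [rinj rlt rdeg]] := degeneracy_order H.
have maxH' : (max_degree H)%:R <= n%:R `^ (1 - e).
  apply: le_trans maxH _; rewrite ler_powR ?ler1n// lerD2l lerN2.
  by rewrite ge_min lexx.
(* If [d < k0], each group has at most one element and [parent_coloring] applies; otherwise any
   colours will do. *)
have [col Hcol] : exists col : 'I_k0 -> V -> bool, (d < k0)%N ->
    forall i u v, u \in back_group H rank i v -> col i u != col i v.
  have [dk|dk] := ltnP d k0; last by exists (fun _ _ => true).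
  have /choice[col Hcol] : forall i : 'I_k0, exists c : V -> bool,
      forall u v, u \in back_group H rank i v -> c u != c v.
    move=> i; apply: (@parent_coloring _ _ rank).
      by move=> u v /group_back/backP[].
    move=> v; apply: leq_trans (card_group k0N rdeg i v) _.
    by rewrite divn_small.
  by exists col => _ i u v; apply: Hcol.
apply: (@threshold_pieces R V n H Vn (piece_index k0) (piece H rank col)) => //.
- by rewrite Lq0 ltW.
- exact: piece_cover.
move=> j; rewrite -/k; suff : 1 - mu (L * q) (hosts n (piece H rank col j)) < (2 * k%:R)^-1.
  by move: (mu _ _) (_^-1) => a b; lra.
have [dk|dk] := ltnP d k0.
  have := @star_piece R V H n k0 rank col k0N Vn rinj rlt rdeg Hcol (L * q) kappa L j.
  move=> /(_ dk kap q0 (lexx _) (ltW Lq) n64)/le_lt_trans; apply.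
  (* The choice of the lower bound on [n] makes [2 / (n %/ 64)] at most the other half,
     [1 / (4 * k)]. *)
  have h1 : (8 * k + 1)%:R <= (n %/ 64)%:R :> R.
    by rewrite ler_nat addn1 leq_divRL// mulnC.
  have h0 : 0 < (n %/ 64)%:R :> R.
    by apply: lt_le_trans h1; rewrite ltr0n addn1.
  have -> : (2 * k%:R)^-1 = (4 * k%:R)^-1 + (4 * k%:R)^-1 :> R.
    by field; rewrite gt_eqF//; lra.
  have k4 : 0 < 4 * k%:R :> R by lra.
  apply: ltr_leD.
    rewrite ltr_pdivrMr ?(lt_le_trans _ kap)// mulrC ltr_pdivlMr//.
    by rewrite /kappa; lra.
  rewrite ler_pdivrMr// mulrC ler_pdivlMr//; move: h1; rewrite natrD natrM.
  by move: (n %/ 64)%N%:R => a; lra.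
have Lqy' : y <= L * q by lra.
have [s [room fin]] := @greedy_parameters R n d k0 (max_degree H) e (L * q)
  e0 e1 k0e dk dl l1 l2 maxH' Lqy' (ltW Lq) n8.
have := @greedy_piece R V H n k0 rank col k0N Vn rinj rlt rdeg (L * q) s j Lq0 (ltW Lq) room.
move=> /le_lt_trans; apply; apply: le_lt_trans fin _.
rewrite ltf_pV2 ?posrE ?mulr_gt0 ?ltr0n//.
rewrite -natrM ltr_nat; apply: leq_trans nk.
by rewrite mulnS; move: k_gt0; move: (k) => m; clear; lia.
Qed.

Theorem theorem1p13 (R : realType) (C eps : R) (hC : 0 < C) (heps : 0 < eps) :
  exists (k : nat) (L : R), (0 < k)%N /\
    exists N : nat, forall n : nat, (N <= n)%N ->
      forall (V : finType) (H : graph V), (#|V| <= n)%N ->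
        (degen H)%:R <= C * (ln n%:R / ln (ln n%:R)) ->
        (max_degree H)%:R <= n%:R `^ (1 - eps) ->
        graph_k_threshold R k n H <= L * graph_expectation_threshold R n H.
Proof.
have [k [L [k0 [N HN]]]] := graph_threshold_bound heps.
exists k, L; split=> //; exists N => n Nn V H Vn _; exact: HN.
Qed.
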